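(* A condensed configuration of a finite matroid without loops or coloops determines every valuative or covaluative matroid invariant. Explicitly: let $M$ and $M'$ be finite matroids without loops or coloops, let $\mathcal P$ be a condensation of $M$ and $\mathcal P'$ a condensation of $M'$, and suppose there is a bijection $\beta:\mathcal P\to\mathcal P'$ with $s_{\beta(B)}=s_B$, $\rho_{\beta(B)}=\rho_B$ and $A_{\mathcal P'}(\beta(B),\beta(C))=A_{\mathcal P}(B,C)$ for all $B,C\in\mathcal P$. Then $\Phi(M)=\Phi(M')$ for every valuative matroid invariant $\Phi$ and every covaluative matroid invariant $\Phi$ with values in an abelian group.
   Context: A flat $X$ of a matroid $M$ is cyclic if the restriction $M|X$ has no coloops. $\mathcal Z(M)$ denotes the lattice of cyclic flats of $M$, ordered by inclusion. Condensed configuration: a condensation of $M$ is a partition $\mathcal P$ of the set $\mathcal Z(M)$ into blocks such that all flats in a block have the same rank and the same cardinality, and such that for any two blocks $B,C\in\mathcal P$ every flat $Y\in C$ contains the same number of flats from $B$. This common number is $A_{\mathcal P}(B,C)=\#\{X\in B\mid X\subseteq Y\}$ for $Y\in C$. For $X\in B$ write $s_B=|X|$ and $\rho_B=\mathrm{rk}(X)$. The condensed configuration is the data consisting of the block labels $(s_B,\rho_B)$ for $B\in\mathcal P$ and the numbers $A_{\mathcal P}(B,C)$ for $B,C\in\mathcal P$. Valuative and covaluative invariants: for a matroid $N$ on a finite set $E$, the base polytope $P(N)\subset\mathbb R^E$ is the convex hull of the indicator vectors of the bases of $N$. A function $\Phi$ from matroids on a fixed finite set $E$ to an abelian group is a valuation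 if $\sum_i a_i\Phi(N_i)=0$ whenever $N_i$ are finitely many matroids on $E$ and $a_i\in\mathbb Z$ satisfy $\sum_i a_i\mathbf 1_{P(N_i)}=0$, where $\mathbf 1$ denotes the indicator function. It is a covaluation if $\sum_i a_i\Phi(N_i)=0$ whenever $\sum_i a_i\mathbf 1_{\mathrm{relint}\,P(N_i)}=0$, where relint denotes the relative interior. A valuative (respectively covaluative) matroid invariant is an isomorphism-invariant function on finite matroids, with values in an abelian group, whose restriction to the matroids on every fixed ground set is a valuation (respectively a covaluation). *)

(* Defs.v *)
From mathcomp Require Import all_boot all_order all_algebra.
Set Implicit Arguments.
Unset Strict Implicit.
Unset Printing Implicit Defensive.

(* A matroid on the ground set E, given by its bases. *)
Definition basis_exchange (E : finType) (BB : {set {set E}}) : bool :=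
  [forall A in BB, forall B in BB, forall x in A :\: B,
     [exists y in B :\: A, y |: (A :\ x) \in BB]].

Record matroid (E : finType) := Matroid {
  bases : {set {set E}};
  bases_neq0 : bases != set0;
  bases_exchange : basis_exchange bases
}.

Section MatroidNotions.
Variables (E : finType) (M : matroid E).
Implicit Types (X Y I : {set E}) (x : E).

Definition indep I : bool := [exists B in bases M, I \subset B].

Definition rk X : nat := \max_(I : {set E} | indep I && (I \subset X)) #|I|.

Definition loop x : bool := [forall B in bases M, x \notin B].

Definition coloop x : bool := [forall B in bases M, x \in B].

Definition no_loops_coloops : Prop := forall x, ~~ loop x /\ ~~ coloop x.

(* The bases of the restriction M|X, as subsets of E. *)
Definition restriction_bases X : {set {set E}} :=
  [set B | maxset (fun I => indep I && (I \subset X)) B].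

Definition coloop_restriction X x : bool :=
  (x \in X) && [forall B in restriction_bases X, x \in B].

Definition flat X : bool := [forall x in ~: X, rk X < rk (x |: X)].

Definition cyclic_flat X : bool :=
  flat X && [forall x, ~~ coloop_restriction X x].

Definition cyclic_flats : {set {set E}} := [set X | cyclic_flat X].

Definition condensation (P : {set {set {set E}}}) : Prop :=
  [/\ partition P cyclic_flats,
      forall B X Y, B \in P -> X \in B -> Y \in B -> rk X = rk Y /\ #|X| = #|Y|
    & forall B C Y Y', B \in P -> C \in P -> Y \in C -> Y' \in C ->
        #|[set X in B | X \subset Y]| = #|[set X in B | X \subset Y']| ].

(* The data below is read off from a chosen flat of the block; on the blocks
   (nonempty) of a condensation the choice is irrelevant. *)
Definition block_flat (B : {set {set E}}) : {set E} :=
  odflt set0 [pick X in B].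

Definition block_size (B : {set {set E}}) : nat := #|block_flat B|.

Definition block_rank (B : {set {set E}}) : nat := rk (block_flat B).

Definition block_count (B C : {set {set E}}) : nat :=
  #|[set X in B | X \subset block_flat C]|.

End MatroidNotions.

Definition matroid_iso (E F : finType) (M : matroid E) (N : matroid F) : Prop :=
  exists2 f : E -> F, bijective f &
    forall B : {set E}, (f @: B \in bases N) = (B \in bases M).

From mathcomp Require Import all_classical all_reals all_analysis.
Import GRing.Theory numFieldNormedType.Exports.
Local Open Scope classical_set_scope.
Local Open Scope ring_scope.

Section Polytopes.
Variables (R : realType) (E : finType).
Local Notation RE := (E -> R^o).

Definition indicator_vector (B : {set E}) : RE := fun i => (i \in B)%:R.

Definition convex_hull (A : set RE) : set RE := smallest (@convex_set R RE) A.

Definition affine_set (A : set RE) : Prop :=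
  forall (x y : RE) (t : R), A x -> A y -> A (t *: x + (1 - t) *: y).

Definition affine_hull (A : set RE) : set RE := smallest affine_set A.

(* R^E carries the product topology. *)
Definition relint (A : set RE) : set RE :=
  [set x | A x /\
     \forall y \near (x : {ptws E -> R^o}), affine_hull A y -> A y].

Definition base_polytope (N : matroid E) : set RE :=
  convex_hull [set indicator_vector B | B in [set B | B \in bases N]].

(* A finite formal combination is given by coefficients a i and matroids N i,
   i < n, with repetitions allowed. *)
Definition valuation (G : zmodType) (Phi : matroid E -> G) : Prop :=
  forall (n : nat) (a : 'I_n -> int) (N : 'I_n -> matroid E),
    (forall x : RE, \sum_(i < n) a i * \1_(base_polytope (N i)) x = 0) ->
    \sum_(i < n) Phi (N i) *~ a i = 0.

Definition covaluation (G : zmodType) (Phi : matroid E -> G) : Prop :=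
  forall (n : nat) (a : 'I_n -> int) (N : 'I_n -> matroid E),
    (forall x : RE,
       \sum_(i < n) a i * \1_(relint (base_polytope (N i))) x = 0) ->
    \sum_(i < n) Phi (N i) *~ a i = 0.

End Polytopes.

Section Invariants.
Variables (R : realType) (G : zmodType).
Variable Phi : forall E : finType, matroid E -> G.

Definition matroid_invariant : Prop :=
  forall (E F : finType) (M : matroid E) (N : matroid F),
    matroid_iso M N -> Phi M = Phi N.

Definition valuative_invariant : Prop :=
  matroid_invariant /\ forall E : finType, valuation R (@Phi E).

Definition covaluative_invariant : Prop :=
  matroid_invariant /\ forall E : finType, covaluation R (@Phi E).

End Invariants.

(* Main.v *)
Require Import Defs.
From mathcomp Require Import all_classical all_analysis.
From mathcomp Require Import all_boot all_order all_algebra reals.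
From mathcomp Require Import zify ring lra.
Set Implicit Arguments.
Unset Strict Implicit.
Unset Printing Implicit Defensive.

(** Let [M] be a matroid of rank [r] without loops or coloops.  A chain [c] of
    nonempty proper cyclic flats of [M] defines a nested matroid [N_c], whose bases
    are the [r]-sets [B] with [#|B :&: Z| <= rk M Z] for [Z] in [c].  Up to
    isomorphism, [N_c] depends only on the sizes and ranks of the members of [c]
    ([profile_iso]).  The proof expands the indicator function of the base polytope
    of [M] into those of the [N_c], as

      [1_M = \sum_(C \subset D) (-1) ^ #|D :\: C| * 1_(N_C)],

    where [D] runs over all chains of nonempty proper cyclic flats and [C] over the
    subchains of [D].  Such a sum is computed from a condensed configuration: the
    number of chains of flats through a given sequence of blocks is a product of
    entries of the matrix of block counts.  [flag_sum_condensed] proves this by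
    descending along the chains, the sum being organised as a recursion from each
    flat to the flats below it ([flag_sum]).

    To prove the expansion, fix a point [x] of the cube [[0, 1]^E] with coordinate
    sum [r].  Both polytopes are described by inequalities: [x] lies in that of [M]
    when [x(Z) <= rk M Z] for all cyclic flats [Z] (Edmonds), and in that of [N_c]
    when this holds for the members of [c] ([base_polytopeP]).  Summing over [C]
    first leaves the alternating sum over the chains of violated flats, that is, up
    to sign, a reduced Euler characteristic ([flag_sum_euler]).  If no flat is
    violated this sum is 1.  Otherwise choose a cyclic flat [U] minimizing the
    submodular function [rk M Z - x(Z)].  The meet of [U] with any violated flat is
    violated again, so that the violated flats form a conically contractible poset
    and the sum is 0 ([euler_cone], [flag_sum_closed]).

    For relative interiors, [x] lies in the open cube and a flat is bad when
    [x(Z) >= rk M Z].  If some inequality is violated, the cone argument applies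
    again.  If none is, the bad flats are the nonempty proper members of a ring of
    sets, made of the sets on which [x] is tight.  When this ring is not closed
    under complements, the union of its atoms is the apex of a cone and the sum is
    0; when it is, it is a Boolean lattice and the sum is 1 or -1.  The second case
    occurs exactly on the relative interior, where the ring consists of the unions
    of connected components.  The same expansion thus holds for relative interiors
    up to a sign depending only on [M] ([flag_sum_open]).

    It remains to see that the signs of the two matroids agree.  Take an interior
    point for the first matroid and sum the expansion over all ways of placing its
    coordinates on the ground set.  The expansions of the two matroids become
    equal, the first being a positive multiple of its sign, the second a
    nonnegative multiple of the other. *)

(** * Rank functions of matroids *)

Section MatroidRank.
Variables (E : finType) (M : matroid E).
Implicit Types (A B I J X Y : {set E}) (x y : E).

Lemma basis_swap A B x :
    A \in bases M -> B \in bases M -> x \in A -> x \notin B ->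
  exists y, [/\ y \in B, y \notin A & y |: (A :\ x) \in bases M].
Proof.
move=> hA hB xA xB; have /forall_inP/(_ A hA)/forall_inP/(_ B hB) := bases_exchange M.
move=> /forall_inP/(_ x); rewrite inE xA xB => /(_ isT) /exists_inP [y].
by rewrite inE => /andP[yA yB] h; exists y.
Qed.

Lemma card_swap A x y : x \in A -> y \notin A -> #|y |: (A :\ x)| = #|A|.
Proof.
move=> xA yA; rewrite cardsU1 !inE (negPf yA) andbF /=.
by rewrite [in RHS](cardsD1 x) xA.
Qed.

Lemma bases_card_le A B : A \in bases M -> B \in bases M -> #|A| <= #|B|.
Proof.
move: {2}_.+1 (ltnSn #|A :\: B|) => n; elim: n A => // n IH A lt hA hB.
have [/subset_leq_card //|/subsetPn[x xA xB]] := boolP (A \subset B).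
have [y [yB yA h]] := basis_swap hA hB xA xB.
rewrite -(card_swap xA yA); apply: IH => //; apply: leq_trans (ltnSE lt).
apply: proper_card; apply/properP; split; last first.
  exists x; rewrite !inE ?xA ?xB //= eqxx /= orbF.
  by apply: contraNN xB => /eqP ->.
apply/subsetP => z; rewrite !inE => /andP[zB /orP[/eqP ez|/andP[_ ->]]]; last by rewrite zB.
by rewrite ez yB in zB.
Qed.

Lemma bases_card A B : A \in bases M -> B \in bases M -> #|A| = #|B|.
Proof. by move=> hA hB; apply/eqP; rewrite eqn_leq !bases_card_le. Qed.

Lemma indepP I : reflect (exists2 B, B \in bases M & I \subset B) (indep M I).
Proof. exact: exists_inP. Qed.

Lemma indepS I J : I \subset J -> indep M J -> indep M I.
Proof.
by move=> IJ /indepP[B hB JB]; apply/indepP; exists B; rewrite ?(subset_trans IJ).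
Qed.

Lemma basis_indep B : B \in bases M -> indep M B.
Proof. by move=> hB; apply/indepP; exists B. Qed.

Lemma exists_basis : exists B, B \in bases M.
Proof. exact/set0Pn/bases_neq0. Qed.

Lemma indep0 : indep M set0.
Proof. by have [B hB] := exists_basis; apply/indepP; exists B; rewrite ?sub0set. Qed.

(** Among the bases containing [I], one that meets a fixed basis containing [J]
    as much as possible lies in the union of [I] with that basis; comparing
    cardinalities then leaves an element of [J] outside [I] in it. *)
Lemma indep_augment I J : indep M I -> indep M J -> #|I| < #|J| ->
  exists x, [/\ x \in J, x \notin I & indep M (x |: I)].
Proof.
move=> /indepP[A0 hA0 IA0] /indepP[B hB JB] lt.
pose P A := (A \in bases M) && (I \subset A).
have PA0 : P A0 by rewrite /P hA0.
case: (@arg_maxnP _ A0 P (fun A => #|A :&: B|) PA0) => A /andP[hA IA] maxA.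
have AIB : A \subset I :|: B.
  apply/subsetP => x xA; rewrite inE; apply/orP; case: (boolP (x \in I)); first by left.
  move=> xI; right; apply: contraT => xB.
  have [y [yB yA h]] := basis_swap hA hB xA xB.
  have PA' : P (y |: (A :\ x)).
    rewrite /P h; apply/subsetP => z zI; rewrite !inE (subsetP IA) // andbT.
    by apply/orP; right; apply: contraNneq xI => <-.
  have := maxA _ PA'; rewrite /= leqNgt => /negP[]; apply: proper_card.
  apply/properP; split; last by exists y; rewrite !inE ?eqxx ?yB //= (negPf yA).
  apply/subsetP => z; rewrite !inE => /andP[zA zB]; rewrite zB zA !andbT.
  by apply/orP; right; apply: contraNneq xB => <-.
have [/existsP[x /and3P[xJ xI xA]]|no] := boolP [exists x, [&& x \in J, x \notin I & x \in A]].
  exists x; split=> //; apply/indepP; exists A => //.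
  by rewrite subUset sub1set xA.
have : A :\: I \subset B :\: J.
  apply/subsetP => x; rewrite !inE => /andP[xI xA].
  have := subsetP AIB _ xA; rewrite inE (negPf xI) /= => ->; rewrite andbT.
  by apply: contra no => xJ; apply/existsP; exists x; rewrite xJ xI.
move/subset_leq_card; rewrite !cardsD (setIidPr IA) (setIidPr JB) (bases_card hA hB).
by have := subset_leq_card JB; lia.
Qed.

Lemma leq_rk I X : indep M I -> I \subset X -> #|I| <= rk M X.
Proof. by move=> hI IX; apply: (@leq_bigmax_cond _ _ (fun J : {set E} => #|J|) I);
  rewrite hI. Qed.

Lemma rk_leqP X n : (forall I, indep M I -> I \subset X -> #|I| <= n) -> rk M X <= n.
Proof. by move=> h; apply/bigmax_leqP => I /andP[]; apply: h. Qed.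

Lemma rk_extend I X : indep M I -> I \subset X ->
  exists J, [/\ indep M J, I \subset J, J \subset X & #|J| = rk M X].
Proof.
move=> hI IX; pose P J := [&& indep M J, I \subset J & J \subset X].
have PI : P I by rewrite /P hI IX subxx.
case: (@arg_maxnP _ I P (fun J => #|J|) PI) => J /and3P[hJ IJ JX] maxJ.
exists J; split=> //; apply/eqP; rewrite eqn_leq leq_rk //=; apply: rk_leqP => K hK KX.
rewrite leqNgt; apply/negP => /(indep_augment hJ hK)[x [xK xJ h]].
have : P (x |: J).
  rewrite /P h (subset_trans IJ) ?subsetUr //= subUset sub1set JX andbT.
  exact: (subsetP KX).
by move/maxJ; rewrite /= cardsU1 xJ add1n ltnn.
Qed.

Lemma rk_attained X : exists J, [/\ indep M J, J \subset X & #|J| = rk M X].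
Proof. by have [J [? _ ? ?]] := rk_extend indep0 (sub0set X); exists J. Qed.

Lemma rkS X Y : X \subset Y -> rk M X <= rk M Y.
Proof. by move=> XY; apply: rk_leqP => I hI IX; apply: leq_rk;
  rewrite ?(subset_trans IX). Qed.

Lemma rk_leq_card X : rk M X <= #|X|.
Proof. by apply: rk_leqP => I _ /subset_leq_card. Qed.

Lemma rk0 : rk M set0 = 0.
Proof. by apply/eqP; rewrite -leqn0 -[X in _ <= X](@cards0 E) rk_leq_card. Qed.

Lemma rk_submod X Y : rk M (X :|: Y) + rk M (X :&: Y) <= rk M X + rk M Y.
Proof.
have [I [hI IXY cI]] := rk_attained (X :&: Y).
have IU : I \subset X :|: Y by rewrite (subset_trans IXY) // subIset // subsetUl.
have [J [hJ IJ JXY cJ]] := rk_extend hI IU.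
have hX : #|J :&: X| <= rk M X by rewrite leq_rk ?subsetIr // (indepS _ hJ) // subsetIl.
have hY : #|J :&: Y| <= rk M Y by rewrite leq_rk ?subsetIr // (indepS _ hJ) // subsetIl.
rewrite -cJ -cI; apply: leq_trans (leq_add hX hY).
rewrite -(cardsUI (J :&: X)) -setIUr (setIidPl JXY) leq_add2l; apply: subset_leq_card.
by rewrite subsetI !subsetI IJ /= -subsetI.
Qed.

Lemma rk_leq_setD X Y : rk M X <= rk M Y + #|X :\: Y|.
Proof.
have := rk_submod Y (X :\: Y); have := rk_leq_card (X :\: Y).
have : rk M X <= rk M (Y :|: (X :\: Y)).
  by apply: rkS; apply/subsetP => x xX; rewrite !inE xX andbT orbN.
by lia.
Qed.

Lemma card_basis B : B \in bases M -> #|B| = rk M setT.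
Proof.
move=> hB; apply/eqP; rewrite eqn_leq leq_rk ?basis_indep ?subsetT //=.
apply: rk_leqP => I /indepP[B' hB' /subset_leq_card h] _.
by rewrite (bases_card hB hB').
Qed.

Lemma basis_of_card I : indep M I -> #|I| = rk M setT -> I \in bases M.
Proof.
move=> /indepP[B hB IB] cI; suff -> : I = B by [].
by apply/eqP; rewrite eqEcard IB (card_basis hB) cI /=.
Qed.

Lemma basis_rk B X : B \in bases M -> #|B :&: X| <= rk M X.
Proof.
by move=> hB; rewrite leq_rk ?subsetIr // (indepS (subsetIl _ _)) // basis_indep.
Qed.

Lemma rk_basis X : exists2 B, B \in bases M & #|B :&: X| = rk M X.
Proof.
have [I [hI IX cI]] := rk_attained X; have /indepP[B hB IB] := hI.
exists B => //; apply/eqP; rewrite eqn_leq basis_rk //= -cI.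
by apply: subset_leq_card; rewrite subsetI IB.
Qed.

Lemma coloop_restrictionE X x :
  coloop_restriction M X x = (x \in X) && (rk M (X :\ x) < rk M X).
Proof.
rewrite /coloop_restriction; case: (boolP (x \in X)) => //= xX.
apply/forall_inP/idP => [h|lt B].
  rewrite ltnNge; apply/negP => le.
  have [I [hI IX cI]] := rk_attained (X :\ x).
  have /h : I \in restriction_bases M X.
    rewrite inE; apply/maxsetP; split.
      by rewrite hI (subset_trans IX) // subD1set.
    move=> J /andP[hJ JX] IJ; apply/esym/eqP; rewrite eqEcard IJ cI.
    by apply: leq_trans le; apply: leq_rk.
  by move/(subsetP IX); rewrite !inE eqxx.
rewrite inE => /maxsetP[/andP[hB BX] maxB].
apply: contraT => xB; have [J [hJ BJ JX cJ]] := rk_extend hB BX.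
have eJ := maxB J; rewrite hJ JX in eJ; have {}eJ := eJ isT BJ.
have : #|B| <= rk M (X :\ x).
  apply: leq_rk => //; apply/subsetP => z zB; rewrite !inE (subsetP BX) // andbT.
  by apply: contraNneq xB => <-.
by rewrite -eJ cJ leqNgt lt.
Qed.

End MatroidRank.

(** * Cyclic flats *)

Section CyclicFlats.
Variables (E : finType) (M : matroid E).
Implicit Types (A B K V X Y Z : {set E}) (x y : E).

Lemma flatP Z : reflect (forall x, x \notin Z -> rk M Z < rk M (x |: Z)) (flat M Z).
Proof.
by apply: (iffP forall_inP) => h x; have := h x; rewrite ?inE.
Qed.

Lemma cyclic_flatP Z : reflect
  (flat M Z /\ forall x, x \in Z -> rk M Z <= rk M (Z :\ x)) (cyclic_flat M Z).
Proof.
apply: (iffP andP) => -[hf hc]; split=> //.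
  by move=> x xZ; move/forallP/(_ x): hc; rewrite coloop_restrictionE xZ /= -leqNgt.
by apply/forallP => x; rewrite coloop_restrictionE negb_and -leqNgt -implybE;
  apply/implyP/hc.
Qed.

Lemma flat_closed Z X x : flat M Z -> X \subset Z -> rk M (x |: X) <= rk M X -> x \in Z.
Proof.
move=> /flatP hZ XZ le; apply: contraT => xZ; have := hZ x xZ.
have := rk_submod M Z (x |: X).
have -> : Z :|: (x |: X) = x |: Z by rewrite setUCA (setUidPl XZ).
have : rk M X <= rk M (Z :&: (x |: X)) by rewrite rkS // subsetI XZ subsetUr.
by lia.
Qed.

Lemma flatI Z W : flat M Z -> flat M W -> flat M (Z :&: W).
Proof.
move=> hZ hW; apply/flatP => x xI; rewrite ltnNge; apply: contra xI => le.
by rewrite inE (flat_closed hZ _ le) ?subsetIl // (flat_closed hW _ le) ?subsetIr.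
Qed.

Lemma closure_exists A : exists Z, [/\ flat M Z, A \subset Z & rk M Z = rk M A].
Proof.
pose P Z := (A \subset Z) && (rk M Z <= rk M A).
have PA : P A by rewrite /P subxx leqnn.
case: (@arg_maxnP _ A P (fun J => #|J|) PA) => Z /andP[AZ le] maxZ.
exists Z; split=> //; last by apply/eqP; rewrite eqn_leq le rkS.
apply/flatP => x xZ; rewrite ltnNge; apply/negP => le2.
have /maxZ : P (x |: Z) by rewrite /P (leq_trans le2) // (subset_trans AZ) // subsetUr.
by rewrite /= cardsU1 xZ add1n ltnn.
Qed.

(** Deleting the coloops of the restriction to a flat leaves its largest cyclic
    flat.  That set is obtained as the smallest [K] for which passing from [A] to
    [K] drops the rank by at least the number of elements removed. *)
Lemma cyclic_part A : flat M A ->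
  exists K, [/\ cyclic_flat M K, K \subset A, rk M K + #|A :\: K| <= rk M A
    & forall V, cyclic_flat M V -> V \subset A -> V \subset K].
Proof.
move=> hA; pose P K := (K \subset A) && (rk M K + #|A :\: K| <= rk M A).
have PA : P A by rewrite /P subxx setDv cards0 addn0 leqnn.
case: (@arg_minnP _ A P (fun J => #|J|) PA) => K /andP[KA le] minK.
have cardD X : X \subset A -> #|A :\: X| = #|A| - #|X|.
  by move=> XA; rewrite cardsD (setIidPr XA).
have card_sub X : X \subset A -> #|X| <= #|A| by apply: subset_leq_card.
have minK1 x : x \in K -> rk M K <= rk M (K :\ x).
  move=> xK; rewrite leqNgt; apply/negP => lt.
  have KxA : K :\ x \subset A by rewrite (subset_trans _ KA) // subD1set.
  have cK := cardsD1 x K; rewrite xK in cK.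
  have : P (K :\ x).
    rewrite /P KxA /=; have := card_sub _ KA; move: le; rewrite !cardD //; lia.
  by move/minK => /=; rewrite cK; lia.
exists K; split=> //.
- apply/cyclic_flatP; split=> //; apply/flatP => x xK.
  rewrite ltnNge; apply/negP => le2.
  have xA : x \in A by apply: flat_closed le2.
  have := rk_leq_setD M A (x |: K).
  have xKA : x |: K \subset A by rewrite subUset sub1set xA.
  have := card_sub _ xKA; have := card_sub _ KA.
  by move: le; rewrite !cardD // cardsU1 xK; lia.
- move=> V /cyclic_flatP[_ hV] VA; apply/subsetP => v vV; apply: contraT => vK.
  have sKV : V :&: K \subset V :\ v.
    apply/subsetP => z; rewrite !inE => /andP[-> zK]; rewrite andbT.
    by apply: contraNneq vK => <-.
  have h1 := rk_leq_setD M (V :\ v) (V :&: K).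
  have h2 := hV v vV; have h3 := rk_submod M V K.
  have UA : V :|: K \subset A by rewrite subUset VA.
  have h4 := rk_leq_setD M A (V :|: K).
  have h5 := cardsUI V K; have h6 := cardsD1 v V; rewrite vV in h6.
  have h7 := card_sub _ UA; have h8 := card_sub _ KA; have h9 := subset_leq_card sKV.
  by move: le h4 h1; rewrite !cardD // [#|(V :\ v) :\: _|]cardsD (setIidPr sKV); lia.
Qed.

(** The rank function is recovered from the cyclic flats: this set attains the
    minimum in [rk A = min_Z (rk Z + #|A :\: Z|)]. *)
Lemma rk_cyclic_flat A :
  exists2 Z, cyclic_flat M Z & rk M Z + #|A :\: Z| <= rk M A.
Proof.
have [X [fX AX eX]] := closure_exists A.
have [K [cK KX le _]] := cyclic_part fX.
exists K => //; rewrite -eX; apply: leq_trans le; rewrite leq_add2l.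
by apply: subset_leq_card; apply: setSD.
Qed.

Hypothesis nlc : no_loops_coloops M.

Lemma setT_cyclic_flat : cyclic_flat M setT.
Proof.
apply/cyclic_flatP; split; first by apply/flatP => x; rewrite inE.
move=> x _; have [_] := nlc x; rewrite /coloop negb_forall_in => /exists_inP[B hB xB].
rewrite -(card_basis hB); apply: leq_rk; first exact: basis_indep.
by apply/subsetP => z zB; rewrite !inE andbT; apply: contraNneq xB => <-.
Qed.

Lemma rk_gt0 Z : Z != set0 -> 0 < rk M Z.
Proof.
case/set0Pn => x xZ; have [] := nlc x.
rewrite /loop negb_forall_in => /exists_inP[B hB]; rewrite negbK => xB _.
by rewrite -(cards1 x) leq_rk ?sub1set // (indepS _ (basis_indep hB)) // sub1set.
Qed.

Lemma rk_ltn_setC Z : Z != setT -> rk M setT < rk M Z + #|~: Z|.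
Proof.
move=> ZT; have [x xZ] : exists x, x \notin Z.
  by apply/existsP; rewrite -negb_forall; apply: contra ZT => /forallP h;
    apply/eqP/setP => z; rewrite inE h.
rewrite ltnNge; apply/negP => le; have [_ /negP[]] := nlc x.
apply/forall_inP => B hB; apply: contraT => xB.
have h1 := basis_rk Z hB; have h2 := card_basis hB; have h3 := cardsID Z B.
have : B :\: Z \subset (~: Z) :\ x.
  apply/subsetP => z; rewrite !inE => /andP[-> zB]; rewrite andbT.
  by apply: contraNneq xB => <-.
move/subset_leq_card; have := cardsD1 x (~: Z); rewrite inE xZ; lia.
Qed.

End CyclicFlats.

(** * Nested matroids *)

Section NestedMatroid.
Variables (E : finType) (M : matroid E).
Implicit Types (A B X Y Z W : {set E}) (x y z : E) (c : seq {set E}).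

Definition nested_bases c : {set {set E}} :=
  [set B : {set E} | (#|B| == rk M setT) && all (fun Z => #|B :&: Z| <= rk M Z) c].

Lemma nested_basesP c B : reflect
  (#|B| = rk M setT /\ forall Z, Z \in c -> #|B :&: Z| <= rk M Z)
  (B \in nested_bases c).
Proof. by rewrite inE; apply: (iffP andP) => -[/eqP ? /allP ?]; split=> //; apply/eqP. Qed.

Lemma bases_nested c : bases M \subset nested_bases c.
Proof.
apply/subsetP => B hB; apply/nested_basesP.
by split=> [|Z _]; [exact: card_basis | exact: basis_rk].
Qed.

Lemma nested_bases_neq0 c : nested_bases c != set0.
Proof.
by have [B hB] := exists_basis M; apply/set0Pn; exists B; apply: (subsetP (bases_nested c)).
Qed.

(** Basis exchange holds when the list is a chain; the value [M] on the other
    lists makes the definition total. *)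
Definition nested_matroid c : matroid E :=
  match @idP (basis_exchange (nested_bases c)) with
  | ReflectT h => Matroid (nested_bases_neq0 c) h
  | ReflectF _ => M
  end.

Definition chain_above Y c := path (fun X Z : {set E} => X \subset Z) Y c.

Lemma subset_transb : transitive (fun X Z : {set E} => X \subset Z).
Proof. by move=> ? ? ?; apply: subset_trans. Qed.

Lemma chain_above_total Y c Z W : chain_above Y c -> Z \in c -> W \in c ->
  Z \subset W \/ W \subset Z.
Proof.
elim: c Y => // X c IH Y /= /andP[_ h].
have hX V : V \in c -> X \subset V by move: V; apply/allP/(order_path_min subset_transb h).
rewrite !inE => /orP[/eqP->|hZ] /orP[/eqP->|hW]; first by left.
- by left; apply: hX.
- by right; apply: hX.
- exact: IH h hZ hW.
Qed.

Lemma chain_above_cons X Y c : X \subset Y -> chain_above Y c -> chain_above X c.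
Proof. by move=> XY; apply: path_le XY; apply: subset_transb. Qed.

(** To restore the constraints after removing [x] from the basis [A], the new
    element has to avoid the largest tight set of the chain not containing [x]. *)
Lemma nested_exchange Y c : chain_above Y c -> basis_exchange (nested_bases c).
Proof.
move=> hc; apply/forall_inP => A /nested_basesP[cA hA].
apply/forall_inP => B /nested_basesP[cB hB]; apply/forall_inP => x.
rewrite inE => /andP[xB xA]; pose F := set0 :: c.
have totF Z W : Z \in F -> W \in F -> Z \subset W \/ W \subset Z.
  rewrite !inE => /orP[/eqP->|hZ] /orP[/eqP->|hW]; rewrite ?sub0set; try by [left|right].
  exact: chain_above_total hc hZ hW.
have leF Z : Z \in F -> #|B :&: Z| <= rk M Z.
  by rewrite inE => /orP[/eqP->|]; [rewrite setI0 cards0 | apply: hB].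
pose P Z := [&& Z \in F, x \notin Z & #|A :&: Z| == rk M Z].
have P0 : P set0 by rewrite /P !inE eqxx setI0 cards0 rk0.
case: (@arg_maxnP _ _ P (fun Z => #|Z|) P0) => Z /and3P[ZF xZ /eqP tZ] maxZ.
have [y [yB yA yZ]] : exists y, [/\ y \in B, y \notin A & y \notin Z].
  have [/existsP[y /and3P[? ? ?]]|no] := boolP [exists y, [&& y \in B, y \notin A & y \notin Z]].
    by exists y.
  have : B :\: Z \subset (A :\: Z) :\ x.
    apply/subsetP => y; rewrite !inE => /andP[yZ yB].
    have yA : y \in A by apply: contraNT no => yA; apply/existsP; exists y; rewrite yB yA.
    by rewrite yZ yA !andbT; apply: contraNneq xB => <-.
  move/subset_leq_card; have := cardsD1 x (A :\: Z); rewrite inE xA xZ.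
  have := cardsID Z A; have := cardsID Z B; have := leF Z ZF; rewrite tZ; lia.
apply/exists_inP; exists y; first by rewrite inE yA.
apply/nested_basesP; split; first by rewrite card_swap.
move=> W Wc; have WF : W \in F by rewrite inE Wc orbT.
have cI : #|A :&: W| = (x \in W) + #|(A :\ x) :&: W|.
  by rewrite (cardsD1 x) inE xA /= setIDAC.
have [yW|yW] := boolP (y \in W); last first.
  apply: leq_trans (hA W Wc); apply: subset_leq_card; apply/subsetP => z.
  by rewrite !inE => /andP[/orP[/eqP->|/andP[_ ->]//]]; rewrite (negPf yW).
have cU : #|(y |: (A :\ x)) :&: W| = (#|(A :\ x) :&: W|).+1.
  rewrite setIUl (_ : [set y] :&: W = [set y]); last by apply/setIidPl; rewrite sub1set.
  by rewrite cardsU1 !inE (negPf yA) andbF.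
have [xW|xW] := boolP (x \in W); first by have := hA W Wc; rewrite cU cI xW.
rewrite cU; move: cI; rewrite (negPf xW) add0n => <-.
rewrite ltn_neqAle hA // andbT; apply/negP => tW.
have /maxZ /= : P W by rewrite /P WF xW.
case: (totF _ _ ZF WF) => [ZW|WZ]; last by rewrite (subsetP WZ) in yZ.
by rewrite leqNgt => /negP[]; apply: proper_card; apply/properP; split=> //; exists y.
Qed.

Lemma bases_nested_matroid Y c :
  chain_above Y c -> bases (nested_matroid c) = nested_bases c.
Proof. 
by move=> /nested_exchange h; rewrite /nested_matroid; case: {-}_ / idP => // /(_ h). Qed.

Section Chain.
Variables (Y : {set E}) (c : seq {set E}) (hc : chain_above Y c).
Let N := nested_matroid c.

Lemma rkT_nested : rk N setT = rk M setT.
Proof.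
have [B hB] := exists_basis N; rewrite -(card_basis hB).
by move: hB; rewrite (bases_nested_matroid hc) => /nested_basesP[].
Qed.

(** A basis meeting [A] in as many elements as possible admits no exchange
    bringing in an element of [A].  The largest tight set of the chain in which
    the basis lies inside [A] therefore contains the rest of [A]. *)
Lemma rk_nested A : exists2 Z, Z \in [:: set0, setT & c] &
  rk M Z + #|A :\: Z| <= rk N A.
Proof.
pose F := [:: set0, setT & c].
have totF Z W : Z \in F -> W \in F -> Z \subset W \/ W \subset Z.
  rewrite !inE => /or3P[/eqP->|/eqP->|hZ] /or3P[/eqP->|/eqP->|hW];
    rewrite ?sub0set ?subsetT; try by [left|right].
  exact: chain_above_total hc hZ hW.
have [B hB eB] := rk_basis N A.
have maxB B' : B' \in nested_bases c -> #|B' :&: A| <= #|B :&: A|.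
  by rewrite -(bases_nested_matroid hc) eB => hB'; apply: basis_rk.
move: hB; rewrite (bases_nested_matroid hc) => /nested_basesP[cB hB].
pose tight Z := (Z \in F) && (#|B :&: Z| == rk M Z).
pose P Z := tight Z && (B :&: Z \subset A).
have P0 : P set0 by rewrite /P /tight !inE eqxx setI0 cards0 rk0 sub0set eqxx.
case: (@arg_maxnP _ _ P (fun Z => #|Z|) P0) => Z /andP[/andP[ZF /eqP tZ] BZA] maxZ.
exists Z => //; rewrite -eB -tZ.
suff sAB : A :\: B \subset Z.
  rewrite -(cardsID Z (B :&: A)); apply: leq_add; apply: subset_leq_card.
    by rewrite subsetI subsetIr andbT subsetI subsetIl.
  apply/subsetP => y; rewrite !inE => /andP[yZ yA]; rewrite yZ yA andbT /=.
  by apply: contraNT yZ => yB; rewrite (subsetP sAB) // inE yA yB.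
apply/subsetP => y; rewrite inE => /andP[yB yA]; apply: contraT => yZ.
pose Q W := tight W && (y \in W).
have QT : Q setT by rewrite /Q /tight !inE eqxx orbT setIT cB eqxx.
case: (@arg_minnP _ _ Q (fun W => #|W|) QT) => W /andP[tW yW] minW.
suff PW : P W.
  have WF : W \in F by case/andP: tW.
  case: (totF _ _ ZF WF) => [ZW|WZ]; last by rewrite (subsetP WZ) in yZ.
  have := maxZ _ PW; rewrite /= leqNgt => /negP[].
  by apply: proper_card; apply/properP; split=> //; exists y.
rewrite /P tW; apply/subsetP => z; rewrite inE => /andP[zB zW]; apply: contraT => zA.
have [zy|zy] := eqVneq z y; first by rewrite -zy zB in yB.
pose B' := y |: (B :\ z).
have : B' \notin nested_bases c.
  apply/negP => /maxB; rewrite leqNgt => /negP[]; apply: proper_card.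
  apply/properP; split; last by exists y; rewrite !inE ?eqxx ?yA // (negPf yB).
  apply/subsetP => t; rewrite !inE => /andP[tB tA]; rewrite tB tA !andbT.
  by apply/orP; right; apply: contraNneq zA => <-.
rewrite inE card_swap // cB eqxx /= => /allPn[X Xc]; rewrite -ltnNge => lt.
have le := hB X Xc.
have Bz : #|(B :\ z) :&: X| + (z \in X) = #|B :&: X|.
  by rewrite [in RHS](cardsD1 z) inE zB /= setIDAC addnC.
have B'X : #|B' :&: X| <= (y \in X) + #|(B :\ z) :&: X|.
  rewrite setIUl; apply: leq_trans (leq_card_setU _ _) _; rewrite leq_add2r.
  have [yX|yX] := boolP (y \in X); first
    by rewrite /= -(cards1 y) subset_leq_card // subsetIl.
  by rewrite leqn0 cards_eq0 -subset0; apply/subsetP => t; rewrite !inE =>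
    /andP[/eqP->]; rewrite (negPf yX).
have yX : y \in X by move: lt le Bz B'X; clear; case: (y \in X); case: (z \in X) =>
  //=; lia.
have zX : z \notin X by move: lt le Bz B'X; rewrite yX; clear; case: (z \in X) => //=; lia.
have tX : tight X.
  rewrite /tight !inE Xc !orbT /=.
  by move: lt le Bz B'X; rewrite yX (negPf zX) eqn_leq; clear; lia.
have /minW /= : Q X by rewrite /Q tX.
have XF : X \in F by case/andP: tX.
have WF : W \in F by case/andP: tW.
case: (totF _ _ WF XF) => [WX|XW]; first by rewrite (subsetP WX) in zX.
by rewrite leqNgt => /negP[]; apply: proper_card; apply/properP; split=> //; exists z.
Qed.

Hypothesis nlc : no_loops_coloops M.

Lemma nested_no_loops_coloops : no_loops_coloops N.
Proof.
move=> x; have [l cl] := nlc x.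
have sub B : B \in bases M -> B \in bases N.
  by rewrite (bases_nested_matroid hc); apply/subsetP/bases_nested.
split; [apply: contra l | apply: contra cl] => /forall_inP h;
  by apply/forall_inP => B /sub/h.
Qed.

(** By the rank formula, the complement of [Z] has rank more than
    [rk M setT - rk M Z] in the nested matroid; a basis meeting this complement in
    that many elements does not reach the bound on [Z]. *)
Lemma nested_not_rigid Z : Z \in c -> Z != set0 -> Z != setT ->
  exists2 B, B \in bases N & #|B :&: Z| < rk M Z.
Proof.
move=> Zc Z0 ZT; have [W WF le] := rk_nested (~: Z).
have [B hB eB] := rk_basis N (~: Z); exists B => //.
have := card_basis hB; rewrite rkT_nested => cB.
have h1 := cardsID Z B; rewrite setDE eB in h1.
have h2 := rk_gt0 nlc Z0; have h3 := rk_ltn_setC nlc ZT.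
suff : rk M setT < rk M Z + (rk M W + #|~: Z :\: W|) by lia.
move: WF; rewrite !inE => /or3P[/eqP->|/eqP->|Wc].
- by rewrite rk0 setD0.
- lia.
case: (chain_above_total hc Zc Wc) => s; last first.
  suff -> : ~: Z :\: W = ~: Z by lia.
  by apply/setDidPl; rewrite disjoint_sym disjoints_subset setCK.
have -> : ~: Z :\: W = ~: W.
  by rewrite setDE -setCU (setUidPr s).
by have := rk_leq_setD M setT W; rewrite setTD; lia.
Qed.

End Chain.
End NestedMatroid.

(** * Inequalities of base polytopes *)

Import Order.TTheory GRing.Theory Num.Theory numFieldNormedType.Exports.
Local Open Scope ring_scope.

Section Mass.
Variables (R : realType) (E : finType).
Implicit Types (A B : {set E}) (x y : E -> R) (i j k : E).

Definition mass x A : R := \sum_(i in A) x i.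

Lemma mass0 x : mass x set0 = 0.
Proof. by rewrite /mass big_set0. Qed.

Lemma mass_setID x A B : mass x A = mass x (A :&: B) + mass x (A :\: B).
Proof. exact: big_setID. Qed.

Lemma massUI x A B : mass x (A :|: B) + mass x (A :&: B) = mass x A + mass x B.
Proof.
rewrite (mass_setID x (A :|: B) A) setUK setDUl setDv set0U (mass_setID x B A).
by rewrite -addrA [mass x (B :\: A) + _]addrC setIC.
Qed.

Lemma massS x A B : (forall i, 0 <= x i) -> A \subset B -> mass x A <= mass x B.
Proof.
move=> x0 AB; rewrite (mass_setID x B A) (setIidPr AB) lerDl.
exact: sumr_ge0.
Qed.

Lemma mass_le_card x A : (forall i, x i <= 1) -> mass x A <= #|A|%:R.
Proof. by move=> x1; rewrite -sumr_const; apply: ler_sum. Qed.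

Lemma mass_indicator B A : mass (fun i => (i \in B)%:R) A = #|B :&: A|%:R.
Proof.
rewrite /mass -sum1_card natr_sum big_mkcond [RHS]big_mkcond /=.
by apply: eq_bigr => i _; rewrite inE; case: (i \in A); case: (i \in B).
Qed.

Lemma mass_combination (s t : R) x y A :
  mass (fun i => s * x i + t * y i) A = s * mass x A + t * mass y A.
Proof. by rewrite /mass big_split /= !mulr_sumr. Qed.

Lemma mass_continuous A x (e : R) : 0 < e ->
  exists2 d : R, 0 < d &
    forall y, (forall i, `|y i - x i| < d) -> `|mass y A - mass x A| < e.
Proof.
move=> e0; exists (e / (#|A|.+1)%:R); first by rewrite divr_gt0.
move=> y hy; rewrite /mass -sumrB; apply: le_lt_trans (ler_norm_sum _ _ _) _.
apply: (@le_lt_trans _ _ (\sum_(i in A) e / (#|A|.+1)%:R)).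
  by apply: ler_sum => i _; apply/ltW/hy.
rewrite sumr_const -[X in X < _]mulr_natr mulrAC ltr_pdivrMr ?ltr0n // ltr_pM2l //.
by rewrite ltr_nat.
Qed.

End Mass.

Section Edmonds.
Variables (R : realType) (E : finType) (N : matroid E).
Implicit Types (A B : {set E}) (x y : E -> R) (i j k : E).

Definition rank_polytope x :=
  [/\ forall i, 0 <= x i, forall A, mass x A <= (rk N A)%:R
    & mass x setT = (rk N setT)%:R].

Definition push i j (t : R) x : E -> R :=
  fun k => x k + t * ((k == i)%:R - (k == j)%:R).

Lemma mass_push i j t x A :
  mass (push i j t x) A = mass x A + t * ((i \in A)%:R - (j \in A)%:R).
Proof.
have D k : \sum_(l in A) (l == k)%:R = (k \in A)%:R :> R.
  have [kA|kA] := boolP (k \in A); last first.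
    by rewrite big1 // => l lA; case: eqP => // e; rewrite -e lA in kA.
  by rewrite (bigD1 k) //= eqxx big1 ?addr0 // => l /andP[_ /negPf->].
by rewrite /mass big_split /= -mulr_sumr sumrB !D.
Qed.

Lemma finite_min (T : finType) (P : pred T) (s : T -> R) (c : R) :
    0 < c -> (forall a, P a -> 0 < s a) ->
  exists t, [/\ 0 < t, t <= c, forall a, P a -> t <= s a
    & t = c \/ exists2 a, P a & t = s a].
Proof.
move=> c0 s0; have [/existsP[a0 /andP[Pa0 lt]]|no] := boolP [exists a, P a && (s a < c)].
  case: (@arg_minP _ R T a0 P s Pa0) => a Pa mina.
  exists (s a); split; [exact: s0| |by []|by right; exists a].
  by apply: le_trans (ltW lt); apply: mina.
exists c; split=> //; last by left.
move=> a Pa; rewrite leNgt; apply: contra no => lt; apply/existsP; exists a.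
by rewrite Pa.
Qed.

Definition tight x A := mass x A == (rk N A)%:R.

(** The measure for the induction in Edmonds' theorem: it decreases when the point
    moves to a proper face of its smallest face. *)
Definition looseness x := (#|[set A | ~~ tight x A]| + #|[set i | x i != 0%R]|)%N.

Lemma tightI x A B : rank_polytope x -> tight x A -> tight x B -> tight x (A :&: B).
Proof.
move=> [_ hx _] /eqP hA /eqP hB; rewrite /tight eq_le hx /=.
have h1 := massUI x A B; have h2 := hx (A :|: B).
have h3 : (rk N (A :|: B))%:R + (rk N (A :&: B))%:R <= (rk N A)%:R + (rk N B)%:R :> R.
  by rewrite -!natrD ler_nat rk_submod.
lra.
Qed.

(** Moving mass from [j] to [i] until a further set becomes tight or the
    coordinate at [j] vanishes. *)
Lemma push_to_face i j x : rank_polytope x -> i != j -> 0 < x i -> 0 < x j ->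
    (forall A, tight x A -> (i \in A) = (j \in A)) ->
  exists t, [/\ 0 < t, rank_polytope (push i j t x)
    & (looseness (push i j t x) < looseness x)%N].
Proof.
move=> [x0 hx xT] ij xi xj hij.
pose P A := (i \in A) && (j \notin A).
have loose A : P A -> 0 < (rk N A)%:R - mass x A.
  move=> /andP[iA jA]; rewrite subr_gt0 lt_neqAle hx andbT.
  by apply: contraNneq jA => eA; rewrite -(hij A) // /tight eA.
have [t [t0 tj tA tE]] := finite_min xj loose.
have pushi k : k != j -> x k <= push i j t x k.
  by move=> kj; rewrite /push (negPf kj) subr0 lerDl mulr_ge0 // ltW.
have pushj : push i j t x j = x j - t.
  by rewrite /push eqxx eq_sym (negPf ij) sub0r mulrN1.
have tight_push A : tight x A -> tight (push i j t x) A.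
  by move=> hA; rewrite /tight mass_push (hij A hA) subrr mulr0 addr0.
exists t; split=> //.
  split.
  - move=> k; have [->|kj] := eqVneq k j; first by rewrite pushj subr_ge0.
    exact: le_trans (pushi k kj).
  - move=> A; rewrite mass_push; have := tA A; rewrite /P; have := hx A.
    case: (i \in A); case: (j \in A) => /= h1 h2;
      rewrite ?subrr ?sub0r ?subr0 ?mulr0 ?mulr1 ?mulrN1 ?addr0 //; last by lra.
    by have := h2 isT; lra.
  - by rewrite mass_push !inE subrr mulr0 addr0.
have sub1 : [set A | ~~ tight (push i j t x) A] \subset [set A | ~~ tight x A].
  by apply/subsetP => A; rewrite !inE; apply: contra; apply: tight_push.
have sub2 : [set k | push i j t x k != 0] \subset [set k | x k != 0].
  apply/subsetP => k; rewrite !inE => h.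
  have [->|kj] := eqVneq k j; first by rewrite gt_eqF.
  have [ki|ki] := eqVneq k i; first by rewrite ki gt_eqF.
  by move: h; rewrite /push (negPf kj) (negPf ki) subrr mulr0 addr0.
have [e|[A PA e]] := tE.
  rewrite /looseness -addnS; apply: leq_add; first exact: subset_leq_card.
  apply: proper_card; apply/properP; split=> //; exists j; rewrite !inE.
    by rewrite gt_eqF.
  by rewrite pushj e subrr eqxx.
rewrite /looseness -addSn; apply: leq_add; last exact: subset_leq_card.
have /andP[iA jA] := PA.
apply: proper_card; apply/properP; split=> //; exists A; rewrite !inE.
  by rewrite /tight lt_eqF // -subr_gt0 loose.
rewrite negbK /tight mass_push iA (negPf jA) subr0 mulr1 e.
by rewrite addrC subrK.
Qed.

Lemma rank_polytope_le1 x i : rank_polytope x -> x i <= 1.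
Proof.
move=> [_ hx _]; have := hx [set i]; rewrite /mass big_set1 => /le_trans-> //.
by rewrite -[1]/(1%:R) ler_nat -(cards1 i) rk_leq_card.
Qed.

(** Take a tight set of least size containing a fractional coordinate.  As the
    mass of the set is an integer, it contains two of them, and by minimality
    every tight set contains both or neither. *)
Lemma fractional_pair x i0 : rank_polytope x -> 0 < x i0 < 1 ->
  exists i j, [/\ i != j, 0 < x i, 0 < x j
    & forall A, tight x A -> (i \in A) = (j \in A)].
Proof.
move=> hx x0; have [xge0 xle xT] := hx.
pose fr i := 0 < x i < 1.
pose P (p : E * {set E}) := [&& fr p.1, tight x p.2 & p.1 \in p.2].
have P0 : P (i0, setT) by rewrite /P /fr x0 /= inE andbT /tight xT.
case: (@arg_minnP _ _ P (fun p => #|p.2|) P0) => -[i A] /and3P[/= fi tA iA] minA.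
have minD k D : fr k -> tight x D -> k \in D -> k \in A -> A \subset D.
  move=> fk tD kD kA; have /minA /= : P (k, A :&: D).
    by rewrite /P /= fk tightI // inE kA.
  move=> le; have /eqP <- : A :&: D == A by rewrite eqEcard subsetIl.
  exact: subsetIr.
have [/existsP[j /and3P[jA ji fj]]|no] := boolP [exists j, [&& j \in A, j != i & fr j]].
  exists i, j; split; [by rewrite eq_sym|by case/andP: fi|by case/andP: fj|].
  move=> D tD; apply/idP/idP => h; first by apply: (subsetP (minD i D _ _ _ _)).
  by apply: (subsetP (minD j D _ _ _ _)).
have other k : k \in A :\ i -> x k = (x k == 1)%:R.
  rewrite !inE => /andP[ki kA]; have : ~~ fr k.
    by apply: contra no => fk; apply/existsP; exists k; rewrite kA ki.
  have := xge0 k; have := rank_polytope_le1 k hx; rewrite /fr.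
  rewrite !le_eqVlt => /orP[/eqP->|l1] /orP[/eqP<-|l0]; rewrite ?eqxx //.
  - by rewrite eq_sym oner_eq0.
  - by rewrite l1 l0.
have : mass x A = x i + (\sum_(k in A :\ i) (x k == 1%R))%:R.
  rewrite /mass (big_setD1 i) //= natr_sum; congr (_ + _).
  exact: eq_bigr.
move: tA => /eqP ->; set n := (\sum_(k in _) _)%N => e.
have /andP[p1 p2] := fi.
have : (n < rk N A)%N by rewrite -(ltr_nat R) e; lra.
have : (rk N A < n.+1)%N by rewrite -(ltr_nat R) e -natr1; lra.
lia.
Qed.

(** A point without fractional coordinate is a basis.  Otherwise, mass can be
    exchanged between two fractional coordinates in both directions, and the point
    lies between two points with more tight constraints. *)
Lemma rank_polytope_hull (K : (E -> R) -> Prop) x :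
    (forall B, B \in bases N -> K (fun i => (i \in B)%:R)) ->
    (forall x y t, 0 <= t <= 1 -> K x -> K y -> K (fun i => t * x i + (1 - t) * y i)) ->
  rank_polytope x -> K x.
Proof.
move=> Kb Kc; move: {2}_.+1 (ltnSn (looseness x)) => n.
elim: n x => // n IH x lt hx.
have [/existsP[i0 fi]|no] := boolP [exists i, 0 < x i < 1].
  have [i [j [ij xi xj tij]]] := fractional_pair hx fi.
  have [s [s0 hs ls]] := push_to_face hx ij xi xj tij.
  have ji : j != i by rewrite eq_sym.
  have tji A : tight x A -> (j \in A) = (i \in A) by move/tij.
  have [t [t0 ht lt']] := push_to_face hx ji xj xi tji.
  have Ks := IH _ (leq_trans ls (ltnSE lt)) hs.
  have Kt := IH _ (leq_trans lt' (ltnSE lt)) ht.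
  have st : s + t != 0 by rewrite gt_eqF // addr_gt0.
  have -> : x = fun k => (t / (s + t)) * push i j s x k
                       + (1 - t / (s + t)) * push j i t x k.
    by apply: funext => k; rewrite /push; field.
  have stp : 0 < s + t by rewrite addr_gt0.
  apply: Kc => //; rewrite ler_pdivrMr // mul1r lerDr (ltW s0) andbT.
  by rewrite ltW // divr_gt0.
have [xge0 xle xT] := hx.
pose B := [set i | x i == 1].
have xE : x = fun i => (i \in B)%:R.
  apply: funext => i; rewrite inE; move: no; rewrite negb_exists => /forallP/(_ i).
  have := xge0 i; have := rank_polytope_le1 i hx.
  rewrite !le_eqVlt => /orP[/eqP->|l1] /orP[/eqP<-|l0]; rewrite ?eqxx //.
  - by rewrite eq_sym oner_eq0.
  - by rewrite l1 l0.
rewrite xE; apply: Kb; apply: basis_of_card.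
  have := xle B; rewrite {1}xE mass_indicator setIid ler_nat => le.
  have [J [hJ JB cJ]] := rk_attained N B.
  by have /eqP <- : J == B by rewrite eqEcard JB cJ.
by move: xT; rewrite {1}xE mass_indicator setIT => /eqP; rewrite eqr_nat => /eqP.
Qed.

End Edmonds.

(** * Base polytopes and their relative interiors *)

Section Hulls.
Variables (R : realType) (E : finType).
Implicit Types (K : (E -> R^o) -> Prop) (x y : E -> R^o).

Definition segment_closed K := forall x y (t : R), 0 <= t <= 1 ->
  K x -> K y -> K (fun i => t * x i + (1 - t) * y i).

Lemma convex_setP K : convex_set (M := E -> R^o) K <-> segment_closed K.
Proof.
split=> [cK x y t /andP[t0 t1] Kx Ky|cK x y t].
  have := cK x y (Itv01 t0 t1); rewrite !in_setE => /(_ Kx Ky).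
  by [].
rewrite !in_setE => Kx Ky; apply: cK => //; by apply/andP; split.
Qed.

Variable N : matroid E.

Lemma base_polytope_sub K :
    segment_closed K -> (forall B, B \in bases N -> K (indicator_vector R B)) ->
  forall x, base_polytope N x -> K x.
Proof.
move=> cK Kb x; apply; split; first exact/convex_setP.
by move=> _ [B /= hB <-]; apply: Kb.
Qed.

Lemma rank_polytope_base_polytope x : rank_polytope N x -> base_polytope N x.
Proof.
move=> hx K [/convex_setP cK Kb]; apply: (rank_polytope_hull _ cK hx) => B hB.
by apply: Kb; exists B.
Qed.

Lemma base_polytope_indicator B : B \in bases N -> base_polytope N (indicator_vector R B).
Proof. by move=> hB K [_]; apply; exists B. Qed.

(** [pointwise_cvgP] asks for a topology on the domain of the functions; [E] is
    given the discrete one. *)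
Lemma ptws_cvgP (F : set_system {ptws E -> R^o}) (x : {ptws E -> R^o}) : Filter F ->
  (F --> x <-> forall i, (fun g : {ptws E -> R^o} => g i) @ F --> x i)%classic.
Proof. by move=> FF; exact: (@pointwise_cvgP (discrete_topology E) R^o F x FF). Qed.

Lemma near_coordinates x (d : R) : 0 < d ->
  \forall y \near (x : {ptws E -> R^o}), forall i, `|y i - x i| < d.
Proof.
move=> d0.
apply: (@filter_forall _ E (fun i =>
  [set y : {ptws E -> R^o} | `|y i - x i| < d]%classic) _ (nbhs_filter _)) => i.
have xx : (nbhs (x : {ptws E -> R^o}) --> (x : {ptws E -> R^o}))%classic by [].
have := (ptws_cvgP _ (nbhs_filter _)).1 xx i.
move=> /cvgrPdist_lt/(_ d d0); apply: filterS => y /=.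
by rewrite distrC.
Qed.

Lemma affine_hull_mass (A : {set E}) (c : R) y :
    (forall B, B \in bases N -> #|B :&: A|%:R = c) ->
  affine_hull (base_polytope N) y -> mass y A = c.
Proof.
move=> hc hy; apply: (hy [set z : E -> R^o | mass z A = c]%classic); split.
  move=> x z t /= hx hz; apply: etrans (mass_combination t (1 - t) x z A) _.
  by rewrite hx hz; ring.
apply: base_polytope_sub; last by move=> B hB /=; rewrite mass_indicator hc.
by move=> x z t _ /= hx hz; rewrite mass_combination hx hz; ring.
Qed.

Lemma near_sup_ball x (d : R) (P : (E -> R^o) -> Prop) : 0 < d ->
  (forall y, (forall i, `|y i - x i| < d) -> P y) ->
  \forall y \near (x : {ptws E -> R^o}), P y.
Proof.
move=> d0 h;
  exact: (@filterS _ _ (nbhs_filter (x : {ptws E -> R^o})) _ _ h (near_coordinates x d0)).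
Qed.

(** The points just beyond [x] on the line from [y] lie in the affine hull and
    tend to [x]. *)
Lemma relint_prolong x y : relint (base_polytope N) x -> base_polytope N y ->
  exists2 t : R, 0 < t & base_polytope N (fun i => x i + t * (x i - y i)).
Proof.
move=> [Px nx] Py; pose z (t : R) : E -> R^o := fun i => x i + t * (x i - y i).
have zx : (z @ (0 : R)^'+ --> (x : {ptws E -> R^o}))%classic.
  apply/ptws_cvgP => i.
  have -> : x i = x i + 0 * (x i - y i) by rewrite mul0r addr0.
  apply: cvg_at_right_filter; apply: cvgD; first exact: cvg_cst.
  by apply: cvgMr_tmp; apply: cvg_id.
have := zx _ nx => /= nz.
have [t [t0 ht]] : exists t : R, 0 < t /\ (affine_hull (base_polytope N) (z t) -> base_polytope N (z t)).
  near ((0 : R)^'+)%classic => t; exists t; split; first by near: t; exact: nbhs_right_gt.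
  by near: t.
exists t => //; apply: ht => K [aK PK].
have -> : z t = (1 + t) *: x + (1 - (1 + t)) *: y.
  by apply: funext => i; rewrite /z /= !fctE /GRing.scale /=; ring.
by apply: aK; apply: PK.
Unshelve. all: by end_near.
Qed.

End Hulls.

(** A family of upper bounds on masses describes the base polytope as soon as it
    determines the rank function through the formula
    [rk A = min_Z (rho Z + #|A :\: Z|)]. *)
Section Facets.
Variables (R : realType) (E : finType) (N : matroid E).
Variables (F : pred {set E}) (rho : {set E} -> nat).
Implicit Types (A B Z : {set E}) (x y : E -> R^o).
Hypothesis rho_ub : forall B Z, B \in bases N -> F Z -> (#|B :&: Z| <= rho Z)%N.
Hypothesis rho_min : forall A, exists2 Z, F Z & (rho Z + #|A :\: Z| <= rk N A)%N.

Lemma base_polytopeP x : base_polytope N x <->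
  [/\ forall i, 0 <= x i <= 1, mass x setT = (rk N setT)%:R
    & forall Z, F Z -> mass x Z <= (rho Z)%:R].
Proof.
split; last first.
  move=> [x01 xT xF]; apply: rank_polytope_base_polytope; split=> //.
    by move=> i; case/andP: (x01 i).
  move=> A; have [Z FZ le] := rho_min A.
  rewrite (mass_setID x A Z); apply: (@le_trans _ _ (rho Z + #|A :\: Z|)%:R); last
    by rewrite ler_nat.
  rewrite natrD; apply: lerD; last by apply: mass_le_card => i; case/andP: (x01 i).
  by apply: le_trans (xF Z FZ); apply: massS (subsetIr _ _) => i; case/andP: (x01 i).
pose K x := [/\ forall i, 0 <= x i <= 1, mass x setT = (rk N setT)%:R
    & forall Z, F Z -> mass x Z <= (rho Z)%:R].
move: x; apply: (@base_polytope_sub _ _ _ K).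
  move=> x y t /andP[t0 t1] [x1 x2 x3] [y1 y2 y3]; split.
  - by move=> i; have := x1 i; have := y1 i; nra.
  - by rewrite mass_combination x2 y2; ring.
  - by move=> Z FZ; rewrite mass_combination; have := x3 Z FZ; have := y3 Z FZ; nra.
move=> B hB; split.
- by move=> i; rewrite /indicator_vector; case: (i \in B); rewrite ?lexx ?ler01.
- by rewrite mass_indicator setIT (card_basis hB).
- by move=> Z FZ; rewrite mass_indicator ler_nat rho_ub.
Qed.

(** An inequality that is strict at some vertex is strict on the relative interior,
    since a segment from that vertex can be prolonged.  The other inequalities are
    equalities on the affine hull. *)
Lemma relint_base_polytopeP x : no_loops_coloops N ->
  relint (base_polytope N) x <->
  [/\ forall i, 0 < x i < 1, mass x setT = (rk N setT)%:R
    & forall Z, F Z -> mass x Z <= (rho Z)%:R /\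
      (mass x Z = (rho Z)%:R -> forall B, B \in bases N -> #|B :&: Z| = rho Z)].
Proof.
move=> nlc; split.
  move=> rx; have [Px _] := rx; have /base_polytopeP[x01 xT xF] := Px.
  have prolong B : B \in bases N -> exists2 t : R, 0 < t &
      base_polytope N (fun i => x i + t * (x i - indicator_vector R B i)).
    by move=> hB; apply: relint_prolong => //; apply: base_polytope_indicator.
  split=> //.
    move=> i; have [] := nlc i; rewrite /loop /coloop !negb_forall_in.
    move=> /exists_inP[B hB]; rewrite negbK => iB /exists_inP[C hC iC].
    have [t t0 /base_polytopeP[/(_ i) + _ _]] := prolong _ hB.
    have [s s0 /base_polytopeP[/(_ i) + _ _]] := prolong _ hC.
    rewrite /indicator_vector iB (negPf iC) /=.
    by have := x01 i; nra.
  move=> Z FZ; split; first exact: xF.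
  move=> e B hB; apply/eqP; rewrite eqn_leq rho_ub //= -(ler_nat R).
  have [t t0 /base_polytopeP[_ _ /(_ Z FZ)]] := prolong _ hB.
  have -> : (fun i => x i + t * (x i - indicator_vector R B i)) =
            fun i => (1 + t) * x i + (- t) * indicator_vector R B i.
    by apply: funext => i; ring.
  by rewrite mass_combination mass_indicator e; nra.
move=> [x01 xT xF]; have Px : base_polytope N x.
  apply/base_polytopeP; split=> // [i|Z /xF[]//].
  by have /andP[? ?] := x01 i; rewrite !ltW.
split=> //.
have [B0 hB0] := exists_basis N.
have n1 : \forall y \near (x : {ptws E -> R^o}), forall i, 0 < y i < 1.
  apply: (@filter_forall _ E (fun i =>
    [set y : {ptws E -> R^o} | 0 < y i < 1]%classic) _ (nbhs_filter _)) => i.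
  have /andP[i0 i1] := x01 i.
  have d0 : 0 < Num.min (x i) (1 - x i) by rewrite lt_min i0 subr_gt0.
  apply: (near_sup_ball d0) => y /(_ i) /=.
  by rewrite lt_min !ltr_norml => /andP[/andP[? ?] /andP[? ?]]; lra.
have n2 : \forall y \near (x : {ptws E -> R^o}), forall Z, F Z ->
    mass x Z < (rho Z)%:R -> mass y Z <= (rho Z)%:R.
  apply: (@filter_forall _ {set E} (fun Z => [set y : {ptws E -> R^o} |
    F Z -> mass x Z < (rho Z)%:R -> mass y Z <= (rho Z)%:R]%classic) _ (nbhs_filter _)) => Z.
  have [lt|ge] := ltP (mass x Z) (rho Z)%:R; last first.
    by apply: (near_sup_ball ltr01).
  have d0 : 0 < (rho Z)%:R - mass x Z by rewrite subr_gt0.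
  have [d dp hd] := mass_continuous Z x d0.
  apply: (near_sup_ball dp) => y /hd hy _ _.
  by move: hy; rewrite ltr_norml => /andP[_]; lra.
apply: (@filterS2 _ (nbhs (x : {ptws E -> R^o})) (nbhs_filter _) _ _ _ _ n1 n2) =>
  y y01 yF ya; apply/base_polytopeP; split.
- by move=> i; have /andP[? ?] := y01 i; rewrite !ltW.
- by apply: affine_hull_mass ya => B hB; rewrite setIT (card_basis hB).
- move=> Z FZ; have [le eq] := xF Z FZ.
  have [e|ne] := eqVneq (mass x Z) (rho Z)%:R; last by apply: yF; rewrite // lt_neqAle ne.
  by rewrite (affine_hull_mass (A := Z) (c := (rho Z)%:R) _ ya) // => B hB; rewrite eq.
Qed.

End Facets.

(** * Euler characteristics of families of sets *)

Section EulerCharacteristic.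
Variable E : finType.
Implicit Types (A B K U V W X Y Z : {set E}) (BB T : {set {set E}}).

(** The unique such [g] sends [Y] to the alternating sum, over all chains of
    members of [BB] properly contained in [Y], of [(-1) ^ length], i.e. to minus
    a reduced Euler characteristic. *)
Definition euler_solution BB (g : {set E} -> int) :=
  forall Y, g Y = 1 - \sum_(X in BB | X \proper Y) g X.

Lemma euler_sum BB g W : euler_solution BB g -> W \in BB ->
  \sum_(V in BB | V \subset W) g V = 1.
Proof.
move=> hg hW; rewrite (bigD1 W) /=; last by rewrite hW subxx.
rewrite [X in X + _](hg W); apply/eqP;
  rewrite -addrA eq_sym -subr_eq0 opprD addrA subrr add0r.
rewrite oppr_eq0 addrC subr_eq0; apply/eqP; apply: eq_bigl => V.
by rewrite properEneq -andbA [(V \subset W) && _]andbC.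
Qed.

Lemma euler_sum_ext BB g g' : euler_solution BB g -> euler_solution BB g' ->
  g =1 g'.
Proof.
move=> hg hg' Y; move: {2}_.+1 (ltnSn #|Y|) => n; elim: n Y => // n IH Y lt.
rewrite hg hg'; congr (_ - _); apply: eq_bigr => X /andP[_ XY]; apply: IH.
exact: leq_trans (proper_card XY) (ltnSE lt).
Qed.

(** A family in which every [W] has a meet with a fixed member [U] is conically
    contractible: [W >= W /\ U <= U].  All contributions from outside the cone
    below [U] vanish. *)
Lemma euler_cone BB g Y U : euler_solution BB g -> U \in BB ->
    (forall W, W \in BB -> exists2 K, K \in BB &
       forall V, V \in BB -> (V \subset K) = (V \subset W) && (V \subset U)) ->
    (forall W, W \in BB -> W \proper Y) ->
  g Y = 0.
Proof.
move=> hg hU meet hY.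
have vanish W : W \in BB -> ~~ (W \subset U) -> g W = 0.
  move: {2}_.+1 (ltnSn #|W|) => n; elim: n W => // n IH W lt hW WU.
  have [K hK eK] := meet W hW.
  rewrite hg -(euler_sum hg hK) [X in _ - X](bigID (fun V => V \subset U)) /=.
  rewrite [X in _ - (_ + X)]big1 ?addr0; last first.
    move=> V /andP[/andP[hV VW]]; apply: IH => //.
    exact: leq_trans (proper_card VW) (ltnSE lt).
  apply/eqP; rewrite subr_eq0; apply/eqP; apply: eq_bigl => V.
  case: (boolP (V \in BB)) => //= hV; rewrite eK // properEneq.
  by case: eqVneq => //= ->; rewrite (negPf WU) andbF.
rewrite hg -(euler_sum hg hU) [X in _ - X](bigID (fun V => V \subset U)) /=.
rewrite [X in _ - (_ + X)]big1 ?addr0; last first.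
  by move=> V /andP[/andP[hV _]]; apply: vanish.
apply/eqP; rewrite subr_eq0; apply/eqP; apply: eq_bigl => V.
by case: (boolP (V \in BB)) => //= hV; rewrite hY.
Qed.

Section RingOfSets.
Variables (T : {set {set E}}) (g : {set E} -> int).
Hypothesis T0 : set0 \in T.
Hypothesis TT : setT \in T.
Hypothesis TI : forall A B, A \in T -> B \in T -> A :&: B \in T.
Hypothesis TU : forall A B, A \in T -> B \in T -> A :|: B \in T.
Let BB := [set X in T | (X != set0) && (X != setT)].
Hypothesis hg : euler_solution BB g.

Definition atom A := [&& A \in T, A != set0 &
  [forall B in T, (B \subset A) ==> (B == set0) || (B == A)]].

Lemma atomP A B : atom A -> B \in T -> B \subset A -> B = set0 \/ B = A.
Proof.
by case/and3P=> _ _ /forall_inP h hB BA; have := h B hB; rewrite BA => /orP[]/eqP; auto.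
Qed.

Lemma atom_below W : W \in T -> W != set0 -> exists2 A, atom A & A \subset W.
Proof.
move=> hW W0; pose P A := [&& A \in T, A != set0 & A \subset W].
have PW : P W by rewrite /P hW W0 subxx.
case: (@arg_minnP _ _ P (fun A => #|A|) PW) => A /and3P[hA A0 AW] minA.
exists A => //; rewrite /atom hA A0; apply/forall_inP => B hB; apply/implyP => BA.
have [//|B0] := eqVneq B set0; rewrite eqEcard BA /=; apply: minA.
by rewrite /P hB B0 (subset_trans BA).
Qed.

(** If the atoms covered the ground set, each complement would be a union of
    atoms.  The union of the atoms is thus proper, and it meets every nonempty
    member in a nonempty member. *)
Lemma euler_not_complemented Z : Z \in T -> ~: Z \notin T -> g setT = 0.
Proof.
move=> hZ hZC; pose U := \bigcup_(A | atom A) A.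
have bigT (P : pred {set E}) : (forall A, P A -> A \in T) -> \bigcup_(A | P A) A \in T.
  by move=> hP; elim/big_ind: _ => // A /hP.
have hU : U \in T by apply: bigT => A /and3P[].
have ZT : Z != set0 by apply: contraNneq hZC => ->; rewrite setC0.
have meetU W : W \in T -> W != set0 -> W :&: U != set0.
  move=> hW W0; have [A hA AW] := atom_below hW W0.
  have /and3P[_ /set0Pn[a aA] _] := hA; apply/set0Pn; exists a.
  by rewrite inE (subsetP AW) //=; apply/bigcupP; exists A.
have UT : U != setT.
  apply: contraNneq hZC => UT.
  suff -> : ~: Z = \bigcup_(A | atom A && (A :&: Z == set0)) A.
    by apply: bigT => A /andP[/and3P[]].
  apply/setP => z; rewrite inE; apply/idP/bigcupP => [zZ|[A /andP[hA /eqP AZ] zA]].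
    have /bigcupP[A hA zA] : z \in U by rewrite UT inE.
    exists A => //; rewrite hA /=; have hA' := hA; case/and3P: hA' => AT _ _.
    have [->//|e] := atomP hA (TI AT hZ) (subsetIl _ _).
    by move: zA; rewrite -e inE (negPf zZ) andbF.
  apply/negP => zZ; have : z \in A :&: Z by rewrite inE zA.
  by rewrite AZ inE.
apply: (@euler_cone BB g setT U hg).
- rewrite inE hU UT andbT /=; have := meetU _ hZ ZT.
  by apply: contraNneq => ->; rewrite setI0.
- move=> W; rewrite inE => /and3P[hW W0 WT].
  exists (W :&: U); last by move=> V _; rewrite subsetI.
  rewrite inE TI // meetU //=.
  by apply: contraNneq WT => e; rewrite -subTset -e subsetIl.
- by move=> W; rewrite inE properT => /and3P[].
Qed.

Hypothesis TC : forall A, A \in T -> ~: A \in T.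

Let sgn X : int := (-1) ^+ #|[set A | atom A & A \subset X]|.

Lemma sgn_atomU A X : atom A -> X \in T -> A :&: X = set0 -> sgn (A :|: X) = - sgn X.
Proof.
move=> hA hX AX; have /and3P[hAT A0 _] := hA.
rewrite /sgn; suff -> : [set B | atom B & B \subset A :|: X] =
    A |: [set B | atom B & B \subset X].
  rewrite cardsU1 inE hA /=; suff -> : A \subset X = false by rewrite exprS mulN1r.
  by apply: contraNF A0 => /setIidPl e; rewrite -e AX.
apply/setP => B; rewrite !inE; have [->|BA] := eqVneq B A; first by rewrite hA subsetUl.
case: (boolP (atom B)) => //= hB; apply/idP/idP => [BAX|/subset_trans->//];
  last exact: subsetUr.
have /and3P[hBT _ _] := hB.
have [BA0|e] := atomP hB (TI hBT hAT) (subsetIl _ _).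
  rewrite -(setIidPl BAX) setIUr BA0 set0U; exact: subsetIr.
have BsA : B \subset A by rewrite -e subsetIr.
have [B0|] := atomP hA hBT BsA; last by move=> e'; rewrite e' eqxx in BA.
by rewrite B0 sub0set.
Qed.

(** Adding or removing a fixed atom contained in [V] is a sign-reversing
    involution. *)
Lemma sgn_sum0 V : V \in T -> V != set0 -> \sum_(X in T | X \subset V) sgn X = 0.
Proof.
move=> hV V0; have [A hA AV] := atom_below hV V0.
have /and3P[hAT A0 _] := hA.
rewrite (bigID (fun X => A \subset X)) /=.
rewrite (reindex_onto (fun X => A :|: X) (fun X => X :\: A)) /=; last first.
  by move=> X /andP[_ AX]; rewrite setDE setUIr setUCr setIT; apply/setUidPr.
apply/eqP; rewrite addr_eq0 -sumrN; apply/eqP.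
have dis X : X \in T -> ~~ (A \subset X) -> A :&: X = set0.
  move=> hX AX; have [//|/setIidPl] := atomP hA (TI hAT hX) (subsetIl _ _).
  by rewrite (negPf AX).
have TD X : X \in T -> X :\: A \in T by move=> hX; rewrite setDE TI // TC.
have cap0 X Y : X :\: A = Y -> A :&: Y = set0.
  by move=> <-; rewrite setDE setICA setICr setI0.
apply: eq_big => X.
  rewrite subsetUl subUset AV andbT /=.
  apply/andP/andP => [[/andP[hAX XV] /eqP e]|[/andP[hX XV] AX]].
    have hX : X \in T by rewrite -e TD.
    rewrite hX XV; split=> //; apply: contra A0 => /setIidPl <-.
    by rewrite (cap0 _ _ e).
  rewrite TU // XV; split=> //; rewrite setDUl setDv set0U; apply/eqP/setDidPl.
  by rewrite disjoint_sym -setI_eq0; apply/eqP; exact: dis hX AX.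
move=> /andP[/andP[/andP[hAX _] _] /eqP e].
by apply: sgn_atomU (cap0 _ _ e) => //; rewrite -e TD.
Qed.

(** In the complemented case [T] is a Boolean lattice whose Moebius function is
    [sgn], and [g] is the opposite of [sgn] on its nonempty members. *)
Lemma euler_complemented : setT != set0 :> {set E} -> g setT = 1 \/ g setT = -1.
Proof.
have h V : V \in T -> V != set0 -> g V = - sgn V.
  move: {2}_.+1 (ltnSn #|V|) => n; elim: n V => // n IH V lt hV V0.
  have := sgn_sum0 hV V0; rewrite (bigD1 V) /=; last by rewrite hV subxx.
  move=> /eqP; rewrite addr_eq0 => /eqP->; rewrite opprK.
  rewrite (bigD1 set0) /=; last by rewrite T0 sub0set eq_sym.
  have -> : sgn set0 = 1.
    rewrite /sgn (_ : [set A | _] = set0) ?cards0 //; apply/setP => A; rewrite !inE.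
    by rewrite subset0; apply/negP => /andP[/and3P[_ /negPf->]].
  rewrite hg; congr (_ + _); rewrite -sumrN; apply: eq_big => X.
    rewrite inE properEneq; case: (boolP (X \in T)) => //= hX.
    case: (eqVneq X set0) => //= X0; rewrite ?andbF //= andbT.
    case: (eqVneq X V) => //= XV; rewrite ?andbF ?andbT //.
    case: (boolP (X \subset V)) => XsV; rewrite ?andbF //= andbT.
    by apply: contraNneq XV => XT; rewrite eqEsubset XsV XT subsetT.
  move=> /andP[]; rewrite inE => /and3P[hX X0 _] XV; rewrite IH ?opprK //.
  exact: leq_trans (proper_card XV) (ltnSE lt).
move=> ET; rewrite h // /sgn -signr_odd; case: odd; rewrite ?expr1 ?expr0 ?opprK; auto.
Qed.

End RingOfSets.
End EulerCharacteristic.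

(** * Sums over marked flags of cyclic flats *)

Section FlagSum.
Variables (E : finType) (M : matroid E).
Implicit Types (X Y Z : {set E}) (c : seq {set E}) (good : pred {set E}).

Definition below Y : {set {set E}} :=
  [set X : {set E} | [&& cyclic_flat M X, X != set0 & X \proper Y]].

(** Descending from [Y], every flat met along the way is either added to the list
    [c] or skipped with a minus sign.  Over the chains [D] of nonempty cyclic
    flats properly contained in [Y], this enumerates the pairs [C \subset D] with
    the sign [(-1) ^ #|D :\: C|]; the recursion stops for lack of flats when [n]
    is at least [#|Y|]. *)
Fixpoint marked_flags n Y c : seq (int * seq {set E}) :=
  (1, c) :: if n is n'.+1 then
    flatten [seq marked_flags n' X (X :: c) ++
                 [seq (- p.1, p.2) | p <- marked_flags n' X c] | X <- enum (below Y)]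
  else [::].

Definition flag_sum (V : zmodType) (w : seq {set E} -> V) n Y c : V :=
  \sum_(p <- marked_flags n Y c) w p.2 *~ p.1.

Lemma flag_sum0 (V : zmodType) (w : seq {set E} -> V) Y c :
  flag_sum w 0 Y c = w c.
Proof. by rewrite /flag_sum /= big_seq1. Qed.

Lemma flag_sumS (V : zmodType) (w : seq {set E} -> V) n Y c :
  flag_sum w n.+1 Y c =
  w c + \sum_(X in below Y) (flag_sum w n X (X :: c) - flag_sum w n X c).
Proof.
rewrite /flag_sum /= big_cons; congr (_ + _).
rewrite big_flatten big_map big_enum /=; apply: eq_bigr => X _.
rewrite big_cat big_map /=; congr (_ + _); rewrite -sumrN.
by apply: eq_bigr => p _; rewrite mulrNz.
Qed.

Definition flag Y c := chain_above Y c &&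
  all (fun X => [&& cyclic_flat M X, X != set0 & X != setT]) c.

Lemma flag_below X Y c : X \in below Y -> flag Y c -> flag X c.
Proof.
rewrite inE => /and3P[_ _ /proper_sub XY] /andP[hc h].
by rewrite /flag h (chain_above_cons XY hc).
Qed.

Lemma flag_cons X Y c : X \in below Y -> flag Y c -> flag X (X :: c).
Proof.
move=> XY fc; have /andP[hc hall] := flag_below XY fc.
move: XY; rewrite inE => /and3P[cX X0 XY].
rewrite /flag /= hall andbT cX X0 /= /chain_above /= subxx -/(chain_above X c) hc /=.
by apply: contraTneq XY => ->; rewrite /proper subsetT andbF.
Qed.

Lemma flag0 Y c : flag Y c -> flag set0 c.
Proof. by case/andP=> hc h; rewrite /flag h (chain_above_cons (sub0set Y)). Qed.

Lemma eq_flag_sum (V : zmodType) (w w' : seq {set E} -> V) n Y c :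
    (forall c', flag set0 c' -> w c' = w' c') -> flag Y c ->
  flag_sum w n Y c = flag_sum w' n Y c.
Proof.
move=> ww; elim: n Y c => [|n IH] Y c hc.
  by rewrite !flag_sum0 ww // (flag0 hc).
rewrite !flag_sumS (ww _ (flag0 hc)); congr (_ + _); apply: eq_bigr => X hX.
by rewrite (IH _ _ (flag_cons hX hc)) (IH _ _ (flag_below hX hc)).
Qed.

Lemma flag_sum_sum (I : finType) (V : zmodType) (P : pred I)
    (w : I -> seq {set E} -> V) n Y c :
  flag_sum (fun c' => \sum_(i | P i) w i c') n Y c = \sum_(i | P i) flag_sum (w i) n Y c.
Proof.
rewrite /flag_sum exchange_big /=; apply: eq_bigr => p _.
exact: mulrz_suml.
Qed.

Definition all_good good c : int := (all good c)%:R.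

Definition bad_flats good : {set {set E}} :=
  [set X : {set E} | [&& cyclic_flat M X, X != set0, X != setT & ~~ good X]].

Lemma flag_sum_good good n Y c :
  flag_sum (all_good good) n Y c = all_good good c * flag_sum (all_good good) n Y [::].
Proof.
elim: n Y c => [|n IH] Y c; first by rewrite !flag_sum0 /all_good /= mulr1.
rewrite !flag_sumS [all_good _ [::]]/all_good /= mulrDr mulr1 mulr_sumr.
congr (_ + _); apply: eq_bigr => X _;
  rewrite IH [flag_sum _ n X c]IH [flag_sum _ n X [:: X]]IH.
by rewrite /all_good /=; case: (good X); case: (all good c);
  rewrite /= ?mul0r ?mul1r ?subrr ?sub0r.
Qed.

Lemma flag_sum_goodS good n Y :
  flag_sum (all_good good) n.+1 Y [::] =
  1 - \sum_(X in bad_flats good | X \proper Y) flag_sum (all_good good) n X [::].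
Proof.
rewrite flag_sumS /all_good /=; congr (_ + _); rewrite -/(all_good good) -sumrN.
rewrite [RHS]big_mkcond [LHS]big_mkcond /=; apply: eq_bigr => X _;
  rewrite !inE flag_sum_good.
have [XY|] := boolP (X \proper Y); rewrite ?andbF // ?andbT.
have -> : X != setT by apply: contraTneq XY => ->; rewrite /proper subsetT andbF.
case: (cyclic_flat M X) => //=; case: (X != set0) => //=.
by rewrite /all_good /= andbT; case: (good X); rewrite ?mul1r ?subrr ?mul0r ?sub0r.
Qed.

Lemma flag_sum_good_stable good n Y : (#|Y| <= n)%N ->
  flag_sum (all_good good) n.+1 Y [::] = flag_sum (all_good good) n Y [::].
Proof.
elim: n Y => [|n IH] Y.
  rewrite leqn0 cards_eq0 => /eqP->;
    rewrite flag_sum_goodS big_pred0 ?flag_sum0 ?subr0 // => X.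
  by rewrite /proper sub0set andbF andbF.
move=> le; rewrite flag_sum_goodS [RHS]flag_sum_goodS; congr (_ - _).
apply: eq_bigr => X /andP[_ XY]; apply: IH.
by rewrite -ltnS (leq_trans (proper_card XY)).
Qed.

(** When [w] is the product of the indicators of [good], summing over the marks
    first leaves the chains of bad flats. *)
Lemma flag_sum_euler good :
  euler_solution (bad_flats good) (fun Y => flag_sum (all_good good) #|E| Y [::]).
Proof. by move=> Y; rewrite -flag_sum_good_stable ?max_card // flag_sum_goodS. Qed.

End FlagSum.

(** * Flag sums of the indicator functions of nested polytopes *)

Section PointSums.
Variables (R : realType) (E : finType) (M : matroid E).
Implicit Types (A B K U W Z : {set E}) (x : E -> R).

Definition defect x A : R := (rk M A)%:R - mass x A.

Definition satisfied x : pred {set E} := fun Z => mass x Z <= (rk M Z)%:R.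

Definition strict x : pred {set E} := fun Z => mass x Z < (rk M Z)%:R.

(** A set is rigid when the rank inequality it defines is an equality on the
    whole base polytope; this means that [M] is the direct sum of its restrictions
    to the set and to the complement. *)
Definition rigid Z := [forall B in bases M, #|B :&: Z| == rk M Z].

Lemma rigidP Z : reflect (forall B, B \in bases M -> #|B :&: Z| = rk M Z) (rigid Z).
Proof. by apply: (iffP forall_inP) => h B /h /eqP. Qed.

Lemma rigidE Z : rigid Z = (rk M Z + rk M (~: Z) == rk M setT)%N.
Proof.
apply/rigidP/eqP => [h|e B hB].
  have [B hB <-] := rk_basis M (~: Z).
  by rewrite -(h B hB) -(card_basis hB) -(cardsID Z B) setDE.
have := cardsID Z B; rewrite setDE (card_basis hB).
by have := basis_rk Z hB; have := basis_rk (~: Z) hB; lia.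
Qed.

Definition interior x :=
  [forall Z, cyclic_flat M Z ==>
     satisfied x Z && ((mass x Z == (rk M Z)%:R) ==> rigid Z)].

Lemma defect0 x : defect x set0 = 0.
Proof. by rewrite /defect rk0 mass0 subr0. Qed.

Lemma defect_submod x A B :
  defect x (A :|: B) + defect x (A :&: B) <= defect x A + defect x B.
Proof.
have h1 := massUI x A B.
have h2 : (rk M (A :|: B))%:R + (rk M (A :&: B))%:R <= (rk M A)%:R + (rk M B)%:R :> R.
  by rewrite -!natrD ler_nat rk_submod.
by rewrite /defect; lra.
Qed.

Lemma defect_le x A Z : (forall i, 0 <= x i <= 1) ->
  (rk M Z + #|A :\: Z| <= rk M A)%N -> defect x Z <= defect x A.
Proof.
move=> x01; rewrite -(ler_nat R) natrD => le.
have h1 := mass_setID x A Z.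
have h2 : mass x (A :&: Z) <= mass x Z.
  by apply: massS (subsetIr _ _) => i; case/andP: (x01 i).
have h3 : mass x (A :\: Z) <= #|A :\: Z|%:R.
  by apply: mass_le_card => i; case/andP: (x01 i).
by rewrite /defect; lra.
Qed.

Lemma exists_minimizer x : exists U, forall A, defect x U <= defect x A.
Proof.
case: (@arg_minP _ R _ set0 xpredT (defect x) isT) => U _ minU.
by exists U => A; apply: minU.
Qed.

(** Adding an element in the closure, or removing a coloop, strictly decreases the
    defect at a point of the open cube. *)
Lemma minimizer_cyclic_flat x A : (forall i, 0 < x i < 1) ->
  (forall B, defect x A <= defect x B) -> cyclic_flat M A.
Proof.
move=> x01 minA; apply/cyclic_flatP; split.
  apply/flatP => i iA; rewrite ltnNge; apply/negP; rewrite -(ler_nat R) => le.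
  have := minA (i |: A); rewrite /defect /mass big_setU1 //=.
  by have /andP[] := x01 i; lra.
move=> i iA; rewrite leqNgt; apply/negP; rewrite -(ler_nat R) -natr1 => le.
have := minA (A :\ i); rewrite /defect /mass (big_setD1 i) //=.
by have /andP[] := x01 i; lra.
Qed.

(** The bad flats are those of negative defect.  The meet with a flat minimizing
    the defect keeps the defect negative, by submodularity. *)
Lemma flag_sum_closed x : (forall i, 0 <= x i <= 1) -> mass x setT = (rk M setT)%:R ->
  flag_sum M (all_good (satisfied x)) #|E| setT [::] =
  [forall Z, cyclic_flat M Z ==> satisfied x Z]%:R.
Proof.
move=> x01 xT; have hg := flag_sum_euler M (satisfied x).
have [good|] := boolP [forall Z, cyclic_flat M Z ==> satisfied x Z].
  rewrite (hg setT) big_pred0 ?subr0 // => Z; rewrite inE.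
  by have := forallP good Z; case: cyclic_flat => //= ->; rewrite !andbF.
rewrite negb_forall => /existsP[Z0]; rewrite negb_imply => /andP[_ badZ0].
have badE Z : ~~ satisfied x Z = (defect x Z < 0) by rewrite -ltNge subr_lt0.
have memE Z : (Z \in bad_flats M (satisfied x)) = cyclic_flat M Z && (defect x Z < 0).
  rewrite inE -badE; case: (cyclic_flat M Z) => //=.
  have [->|_] := eqVneq Z set0; first by rewrite badE defect0 ltxx.
  by have [->|_] := eqVneq Z setT; first by rewrite badE /defect xT subrr ltxx.
have [U0 minU0] := exists_minimizer x.
have [U cU /(defect_le x01) leU] := rk_cyclic_flat M U0.
have minU A : defect x U <= defect x A := le_trans leU (minU0 A).
refine (euler_cone (U := U) hg _ _ _).
- by rewrite memE cU /=; apply: le_lt_trans (minU Z0) _; rewrite -badE.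
- move=> W; rewrite memE => /andP[cW dW].
  have fA : flat M (W :&: U) by case/cyclic_flatP: cU => ? _; case/cyclic_flatP: cW =>
    ? _; apply: flatI.
  have [K [cK KA /(defect_le x01) leK maxK]] := cyclic_part fA.
  exists K; last first.
    move=> V; rewrite memE -subsetI => /andP[cV _].
    by apply/idP/idP => [/subset_trans->//|]; apply: maxK.
  rewrite memE cK /=; have := defect_submod x W U; have := minU (W :|: U); lra.
- move=> W; rewrite memE properT => /andP[_]; apply: contraTneq => ->.
  by rewrite /defect xT subrr ltxx.
Qed.

Section Open.
Variable x : E -> R.
Hypothesis x01 : forall i, 0 < x i < 1.
Hypothesis xT : mass x setT = (rk M setT)%:R.
Let BB := bad_flats M (strict x).
Let hg := flag_sum_euler M (strict x).

Lemma box_strictW i : 0 <= x i <= 1.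
Proof. by have /andP[? ?] := x01 i; rewrite !ltW. Qed.

Lemma bad_strictE Z :
  (Z \in BB) = [&& cyclic_flat M Z, Z != set0, Z != setT & defect x Z <= 0].
Proof. by rewrite inE /strict -leNgt subr_le0. Qed.

(** If some defect is negative, the largest minimizer of the defect serves as the
    apex of a cone. *)
Lemma flag_sum_open_outside A : defect x A < 0 ->
  flag_sum M (all_good (strict x)) #|E| setT [::] = 0.
Proof.
move=> dA; have [U0 minU0] := exists_minimizer x.
pose P U := defect x U == defect x U0.
have PU0 : P U0 by rewrite /P.
case: (@arg_maxnP _ _ P (fun U => #|U|) PU0) => U /eqP eU maxU.
have minU B : defect x U <= defect x B by rewrite eU.
have dU : defect x U < 0 by apply: le_lt_trans (minU A) dA.
have cU := minimizer_cyclic_flat x01 minU.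
refine (euler_cone (U := U) hg _ _ _).
- rewrite bad_strictE cU (ltW dU) andbT /=; apply/andP; split.
    by apply: contraTneq dU => ->; rewrite defect0 ltxx.
  by apply: contraTneq dU => ->; rewrite /defect xT subrr ltxx.
- move=> W; rewrite bad_strictE => /and4P[cW W0 WT dW].
  have fA : flat M (W :&: U) by case/cyclic_flatP: cU => ? _; case/cyclic_flatP: cW =>
    ? _; apply: flatI.
  have [K [cK KA /(defect_le box_strictW) leK maxK]] := cyclic_part fA.
  have sub := defect_submod x W U.
  exists K; last first.
    move=> V; rewrite bad_strictE -subsetI => /andP[cV _].
    by apply/idP/idP => [/subset_trans->//|]; apply: maxK.
  rewrite bad_strictE cK /=; apply/and3P; split.
    (* If the meet were empty, the join would be a larger minimizer. *)
  + apply: contraNneq W0 => K0; rewrite K0 defect0 in leK.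
    have /maxU /= : P (W :|: U).
      by rewrite /P -eU eq_le minU andbT; lra.
    move=> le; have WU : W \subset U.
      have /eqP -> : U == W :|: U by rewrite eqEcard subsetUr.
      exact: subsetUl.
    by rewrite -subset0 -K0; apply: maxK => //; rewrite subsetI subxx.
  + apply: contraNneq WT => KT; rewrite -subTset -KT.
    by rewrite (subset_trans KA) // subsetIl.
  + have := minU (W :|: U); lra.
- by move=> W; rewrite bad_strictE properT => /and4P[].
Qed.

Section Nonnegative.
Hypothesis defect_ge0 : forall A, 0 <= defect x A.
Let T := [set A : {set E} | defect x A == 0].

Lemma tight_cyclic_flat A : A \in T -> cyclic_flat M A.
Proof.
rewrite inE => /eqP e; apply: minimizer_cyclic_flat x01 _ => B.
by rewrite e defect_ge0.
Qed.

Lemma tightIU A B : A \in T -> B \in T -> (A :&: B \in T) /\ (A :|: B \in T).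
Proof.
rewrite !inE => /eqP a /eqP b; have := defect_submod x A B; rewrite a b.
have := defect_ge0 (A :&: B); have := defect_ge0 (A :|: B) => h1 h2 h3.
by split; rewrite eq_le ?h1 ?h2 andbT; lra.
Qed.

Lemma tight_set0 : set0 \in T.
Proof. by rewrite inE defect0. Qed.

Lemma tight_setT : setT \in T.
Proof. by rewrite inE /defect xT subrr. Qed.

Lemma bad_tight : BB = [set X in T | (X != set0) && (X != setT)].
Proof.
apply/setP => Z; rewrite bad_strictE inE; apply/and4P/and3P => [[cZ Z0 ZT dZ]|[hZ Z0 ZT]].
  by rewrite inE eq_le dZ defect_ge0.
by rewrite tight_cyclic_flat //; split=> //; move: hZ; rewrite inE => /eqP->.
Qed.

Lemma tight_complement Z : Z \in T -> (~: Z \in T) = rigid Z.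
Proof.
rewrite !inE rigidE => /eqP dZ; have := mass_setID x setT Z.
rewrite setTI setTD xT => e; rewrite -(eqr_nat R) natrD.
by apply/eqP/eqP; move: dZ; rewrite /defect; lra.
Qed.

Lemma rigid_tight Z : rigid Z -> Z \in T.
Proof.
rewrite inE rigidE => /eqP e; have := mass_setID x setT Z.
rewrite setTI setTD xT -e natrD; have := defect_ge0 Z; have := defect_ge0 (~: Z).
by rewrite /defect => *; apply/eqP; lra.
Qed.

Lemma flag_sum_open_boundary Z : Z \in T -> ~~ rigid Z ->
  flag_sum M (all_good (strict x)) #|E| setT [::] = 0.
Proof.
move=> hZ rZ; move: hg; rewrite -/BB bad_tight => hgT.
apply: (euler_not_complemented tight_set0 tight_setT _ _ hgT hZ).
- by move=> A B hA /(tightIU hA)[].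
- by move=> A B hA /(tightIU hA)[].
- by rewrite tight_complement.
Qed.

(** Here the bad flats are the rigid ones, whatever the point. *)
Lemma flag_sum_open_interior : (forall Z, Z \in T -> rigid Z) ->
  flag_sum M (all_good (strict x)) #|E| setT [::] =
  flag_sum M (all_good (fun Z => ~~ rigid Z)) #|E| setT [::].
Proof.
move=> hT; refine (euler_sum_ext
  (g' := fun Y => flag_sum M (all_good (fun Z => ~~ rigid Z)) #|E| Y [::]) hg _ setT).
suff e : BB = bad_flats M (fun Z => ~~ rigid Z) by rewrite -/BB e; apply: flag_sum_euler.
rewrite bad_tight; apply/setP => Z; rewrite [RHS]inE negbK inE.
apply/and3P/and4P => [[hZ ? ?]|[? ? ? /rigid_tight ?]]; last by split.
by split=> //; [apply: tight_cyclic_flat | apply: hT].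
Qed.

Lemma flag_sum_open_pm1 : (forall Z, Z \in T -> rigid Z) ->
  let s := flag_sum M (all_good (strict x)) #|E| setT [::] in s = 1 \/ s = -1.
Proof.
move=> hT /=; have [ET|ET] := eqVneq [set: E] set0.
  left; rewrite (hg setT) big_pred0 ?subr0 // => Z.
  by rewrite ET /proper sub0set andbF andbF.
move: hg; rewrite -/BB bad_tight => hgT.
apply: (euler_complemented tight_set0 tight_setT _ _ hgT _ ET).
- by move=> A B hA /(tightIU hA)[].
- by move=> A B hA /(tightIU hA)[].
- by move=> A hA; rewrite tight_complement ?hT.
Qed.

End Nonnegative.

Lemma interior_ge0 : interior x -> forall A, 0 <= defect x A.
Proof.
move=> /forallP h A; have [Z cZ /(defect_le box_strictW)] := rk_cyclic_flat M A.
apply: le_trans; have := h Z; rewrite cZ /= => /andP[+ _].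
by rewrite /satisfied /defect subr_ge0.
Qed.

Lemma interior_rigid : interior x -> forall Z, Z \in [set A | defect x A == 0] -> rigid Z.
Proof.
move=> hx Z hZ; have /implyP/(_ (tight_cyclic_flat (interior_ge0 hx) hZ)) := forallP hx Z.
by case/andP=> _ /implyP; apply; move: hZ; rewrite inE subr_eq0 eq_sym.
Qed.

(** When [M] has no loops or coloops, its rigid cyclic flats are the unions of
    connected components; for a nonempty ground set, this number is then
    [(-1) ^ (k - 1)], where [k] is the number of components. *)
Definition interior_sign : int :=
  flag_sum M (all_good (fun Z => ~~ rigid Z)) #|E| setT [::].

Lemma flag_sum_open : flag_sum M (all_good (strict x)) #|E| setT [::] =
  interior_sign * (interior x)%:R.
Proof.
have [hx|hx] := boolP (interior x); rewrite ?mulr1 ?mulr0.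
  exact: flag_sum_open_interior (interior_ge0 hx) (interior_rigid hx).
have [/existsP[A dA]|] := boolP [exists A, defect x A < 0].
  exact: flag_sum_open_outside dA.
rewrite negb_exists => /forallP nn.
have dge0 A : 0 <= defect x A by rewrite leNgt.
move: hx; rewrite negb_forall => /existsP[Z]; rewrite negb_imply negb_and => /andP[_].
rewrite {1}/satisfied -subr_ge0 dge0 /= negb_imply => /andP[e].
by apply: flag_sum_open_boundary dge0 _ _; rewrite inE subr_eq0 eq_sym.
Qed.

End Open.

(** The barycenter of the vertices satisfies strictly all the inequalities that
    are not equalities on the base polytope. *)
Lemma exists_interior : no_loops_coloops M ->
  exists x, [/\ forall i, 0 < x i < 1, mass x setT = (rk M setT)%:R & interior x].
Proof.
move=> nlc; have b0 : 0 < #|bases M|%:R :> R.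
  by rewrite ltr0n card_gt0 bases_neq0.
pose x i : R := (\sum_(B in bases M) (i \in B)%:R) / #|bases M|%:R.
have massE A : mass x A * #|bases M|%:R = \sum_(B in bases M) #|B :&: A|%:R.
  rewrite /mass /x -mulr_suml divfK ?gt_eqF // exchange_big /=.
  by apply: eq_bigr => B _; rewrite -mass_indicator.
exists x; split.
- move=> i; have [] := nlc i; rewrite /loop /coloop !negb_forall_in.
  move=> /exists_inP[B hB]; rewrite negbK => iB /exists_inP[C hC iC].
  rewrite /x divr_gt0 //=; last first.
    by rewrite (bigD1 B) //= iB ltr_pwDl // sumr_ge0.
  rewrite ltr_pdivrMr // mul1r -sum1_card natr_sum (bigD1 C) //= [ltRHS](bigD1 C) //=.
  rewrite (negPf iC) add0r ltr_pwDl // ler_sum // => D _.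
  by case: (i \in D); rewrite ?lexx ?ler01.
- apply: (mulIf (lt0r_neq0 b0)); rewrite massE.
  under eq_bigr => B hB do rewrite setIT (card_basis hB).
  by rewrite sumr_const mulr_natr.
- apply/forallP => Z; apply/implyP => _; apply/andP; split.
    rewrite /satisfied -(ler_pM2r b0) massE mulr_natr -sumr_const.
    by apply: ler_sum => B hB; rewrite ler_nat basis_rk.
  apply/implyP => /eqP e; apply/rigidP => B hB; apply/eqP.
  rewrite eqn_leq basis_rk //= leqNgt; apply/negP => lt.
  have : mass x Z * #|bases M|%:R < (rk M Z)%:R * #|bases M|%:R.
    rewrite massE mulr_natr -sumr_const (bigD1 B) //= [ltRHS](bigD1 B) //=.
    rewrite ltr_leD ?ltr_nat // ler_sum // => D /andP[hD _].
    by rewrite ler_nat basis_rk.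
  by rewrite e ltxx.
Qed.

Lemma interior_sign_pm1 : no_loops_coloops M -> interior_sign = 1 \/ interior_sign = -1.
Proof.
move=> nlc; have [x [x01 xT hx]] := exists_interior nlc.
have := flag_sum_open_pm1 x01 xT (interior_ge0 x01 hx) (interior_rigid x01 hx).
by rewrite /= flag_sum_open // hx mulr1.
Qed.

End PointSums.

(** * Comparison of two matroids with the same condensed configuration *)

Section ChainBijection.

(** The ground set is listed so that every member of the chain is an initial
    segment; matching two such listings gives the bijection of
    [chain_bijection]. *)
Lemma chain_listing (E : finType) (Y : {set E}) (s0 : seq E) c :
    uniq s0 -> s0 =i Y -> chain_above Y c ->
  exists s, [/\ uniq s, forall e, e \in s, take #|Y| s = s0
    & forall X, X \in c -> X =i take #|X| s].
Proof.
elim: c Y s0 => [|X c IH] Y s0 us0 s0Y.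
  have ss0 : size s0 = #|Y| by rewrite -(card_uniqP us0); apply: eq_card.
  move=> _; exists (s0 ++ enum (~: Y)); split=> //; last by rewrite -ss0 take_size_cat.
    rewrite cat_uniq us0 enum_uniq andbT; apply/hasPn => e.
    by rewrite mem_enum inE s0Y.
  by move=> e; rewrite mem_cat mem_enum s0Y inE orbN.
have ss0 : size s0 = #|Y| by rewrite -(card_uniqP us0); apply: eq_card.
move=> /= /andP[YX hc]; set s1 := s0 ++ enum (X :\: Y).
have us1 : uniq s1.
  rewrite cat_uniq us0 enum_uniq andbT; apply/hasPn => e.
  by rewrite mem_enum inE s0Y => /andP[].
have s1X : s1 =i X.
  move=> e; rewrite mem_cat mem_enum s0Y inE.
  by case: (boolP (e \in Y)) => //= eY; rewrite (subsetP YX).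
have [s [us hs e hX]] := IH X s1 us1 s1X hc.
exists s; split=> //.
  by rewrite -(take_takel _ (subset_leq_card YX)) e -ss0 take_size_cat.
move=> Z; rewrite inE => /orP[/eqP->|]; last exact: hX.
by move=> z; rewrite e s1X.
Qed.

Lemma chain_bijection (E E' : finType) (c : seq {set E}) (c' : seq {set E'}) :
    #|E| = #|E'| -> chain_above set0 c -> chain_above set0 c' ->
    [seq #|X : {set E}| | X <- c] = [seq #|X : {set E'}| | X <- c'] ->
  exists2 f : E -> E', bijective f &
    forall k e, (f e \in nth set0 c' k) = (e \in nth set0 c k).
Proof.
move=> EE' hc hc' sz.
have nil0 (T : finType) : [::] =i (set0 : {set T}) by move=> e; rewrite !inE.
have [s [us hs _ sX]] := chain_listing (isT : uniq [::]) (nil0 E) hc.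
have [s' [us' hs' _ sX']] := chain_listing (isT : uniq [::]) (nil0 E') hc'.
have size_s : size s = #|E| by rewrite -(card_uniqP us); apply: eq_card.
have size_s' : size s' = #|E'| by rewrite -(card_uniqP us'); apply: eq_card.
have lt e : (index e s < size s')%N by rewrite size_s' -EE' -size_s index_mem.
pose f e := tnth (in_tuple s') (Ordinal (lt e)).
have idx e : index (f e) s' = index e s.
  by rewrite /f (tnth_nth (f e)) index_uniq.
exists f.
  apply: inj_card_bij; last by rewrite EE'.
  by move=> a b /(congr1 (index^~ s')); rewrite !idx; apply: index_inj.
move=> k e; have szc : size c = size c' by rewrite -(size_map (fun X : {set E} =>
  #|X|)) sz size_map.
have [kc|kc] := ltnP k (size c); last by rewrite !nth_default ?inE // -szc.
have kc' : (k < size c')%N by rewrite -szc.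
rewrite (sX _ (mem_nth set0 kc)) (sX' _ (mem_nth set0 kc')) !in_take // idx.
suff -> : #|nth set0 c k| = #|nth set0 c' k| by [].
by rewrite -(nth_map set0 0%N (fun X : {set E} => #|X|)) // sz (nth_map set0).
Qed.

End ChainBijection.

Section Profiles.
Variables (E E' : finType) (M : matroid E) (M' : matroid E').

Definition profile (F : finType) (N : matroid F) c : seq (nat * nat) :=
  [seq (#|X : {set F}|, rk N X) | X <- c].

Hypothesis EE' : #|E| = #|E'|.
Variables (c : seq {set E}) (c' : seq {set E'}).
Hypothesis hc : chain_above set0 c.
Hypothesis hc' : chain_above set0 c'.
Hypothesis cc' : profile M c = profile M' c'.

Lemma profile_size : size c = size c'.
Proof. by have := congr1 size cc'; rewrite !size_map. Qed.

Lemma profile_bijection : exists2 f : E -> E', bijective f &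
  forall k e, (f e \in nth set0 c' k) = (e \in nth set0 c k).
Proof.
apply: chain_bijection => //.
by have := congr1 (map fst) cc'; rewrite -!map_comp.
Qed.

Lemma profile_rk k : rk M (nth set0 c k) = rk M' (nth set0 c' k).
Proof.
have [kc|kc] := ltnP k (size c); last by rewrite !nth_default ?rk0 // -profile_size.
have := congr1 (fun s => nth (0, 0)%N s k) cc'.
by rewrite !(nth_map set0) -?profile_size // => -[].
Qed.

Lemma profile_iso : rk M setT = rk M' setT ->
  matroid_iso (nested_matroid M c) (nested_matroid M' c').
Proof.
move=> rT; have [f bf hf] := profile_bijection; exists f => // B.
have finj := bij_inj bf.
have fI k : #|(f @: B) :&: nth set0 c' k| = #|B :&: nth set0 c k|.
  rewrite -(card_imset _ finj); congr #|pred_of_set _|; apply/setP => e'; rewrite inE.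
  apply/andP/imsetP => [[/imsetP[e eB ->]]|[e]]; first by rewrite hf => h; exists e;
    rewrite // inE eB.
  by rewrite inE => /andP[eB h] ->; rewrite hf imset_f.
rewrite (bases_nested_matroid M hc) (bases_nested_matroid M' hc').
apply/nested_basesP/nested_basesP => -[cB h]; split.
- by rewrite rT -cB card_imset.
- move=> Z /(nthP set0)[k kc <-]; rewrite -fI profile_rk h // mem_nth //.
  by rewrite -profile_size.
- by rewrite card_imset // -rT.
- move=> Z /(nthP set0)[k kc <-]; rewrite fI -profile_rk h // mem_nth //.
  by rewrite profile_size.
Qed.

End Profiles.

Section CondensedConfiguration.
Variables (E E' : finType) (M : matroid E) (M' : matroid E').
Variables (P : {set {set {set E}}}) (P' : {set {set {set E'}}}).
Variable beta : {set {set E}} -> {set {set E'}}.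
Hypothesis nlc : no_loops_coloops M.
Hypothesis nlc' : no_loops_coloops M'.
Hypothesis hP : condensation M P.
Hypothesis hP' : condensation M' P'.
Hypothesis beta_inj : {in P &, injective beta}.
Hypothesis beta_im : beta @: P = P'.
Hypothesis beta_size : forall B, B \in P -> block_size (beta B) = block_size B.
Hypothesis beta_rank : forall B, B \in P -> block_rank M' (beta B) = block_rank M B.
Hypothesis beta_count : forall B C, B \in P -> C \in P ->
  block_count (beta B) (beta C) = block_count B C.

Section Blocks.
Variables (F : finType) (N : matroid F) (Q : {set {set {set F}}}).
Hypothesis hQ : condensation N Q.
Implicit Types (B C : {set {set F}}) (X Y : {set F}).

Lemma mem_block_flat B : B \in Q -> block_flat B \in B.
Proof.
case: hQ => /and3P[_ _ Q0] _ _ hB; rewrite /block_flat; case: pickP => //= no.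
by case/negP: Q0; rewrite -(_ : B = set0) //; apply/setP => X; rewrite inE no.
Qed.

Lemma block_sizeE B X : B \in Q -> X \in B -> block_size B = #|X|.
Proof. by case: hQ => _ h _ hB hX; case: (h B _ X hB (mem_block_flat hB) hX). Qed.

Lemma block_rankE B X : B \in Q -> X \in B -> block_rank N B = rk N X.
Proof. by case: hQ => _ h _ hB hX; case: (h B _ X hB (mem_block_flat hB) hX). Qed.

Lemma block_countE B C Y : B \in Q -> C \in Q -> Y \in C ->
  block_count B C = #|[set X in B | X \subset Y]|.
Proof. by case: hQ => _ _ h hB hC hY; apply: h (mem_block_flat hC) hY. Qed.

Lemma block_cyclic_flat B X : B \in Q -> X \in B -> cyclic_flat N X.
Proof.
case: hQ => /and3P[/eqP cov _ _] _ _ hB hX.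
have : X \in cover Q by apply/bigcupP; exists B.
by rewrite cov inE.
Qed.

Lemma cyclic_flat_block X : cyclic_flat N X -> exists2 B, B \in Q & X \in B.
Proof.
case: hQ => /and3P[/eqP cov _ _] _ _ cX.
have : X \in cover Q by rewrite cov inE.
by case/bigcupP => B; exists B.
Qed.

Lemma sum_below (V : zmodType) (H : {set F} -> V) Y :
  \sum_(X in below N Y) H X = \sum_(B in Q) \sum_(X in B :&: below N Y) H X.
Proof.
have hpart : partition Q (cyclic_flats N) by case: hQ.
under [RHS]eq_bigr => B _ do under eq_bigl => X do rewrite inE.
rewrite -(set_partition_big_cond _ hpart) /=; apply: eq_bigl => X.
by rewrite !inE; case: (cyclic_flat N X).
Qed.

Lemma block_below B C Y : B \in Q -> C \in Q -> Y \in C ->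
  #|B :&: below N Y| =
  if (0 < block_size B < block_size C)%N then block_count B C else 0%N.
Proof.
move=> hB hC hY; rewrite (block_countE hB hC hY) (block_sizeE hC hY).
have h X : X \in B -> (X \in below N Y) =
    (0 < block_size B < #|Y|)%N && (X \subset Y).
  move=> hX; rewrite inE (block_cyclic_flat hB hX) (block_sizeE hB hX) card_gt0 /=.
  rewrite -andbA; congr (_ && _); apply/idP/andP => [XY|[lt XY]].
    by rewrite proper_sub // proper_card.
  by rewrite properEcard XY.
case: ifP => hcond; last first.
  apply/eqP; rewrite cards_eq0; apply/eqP/setP => X; rewrite inE [RHS]inE.
  by case: (boolP (X \in B)) => //= hX; rewrite h // hcond.
apply: eq_card => X; rewrite [LHS]inE [RHS]inE.
by case: (boolP (X \in B)) => //= hX; rewrite h // hcond.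
Qed.

End Blocks.

Lemma sum_const_eq (I J : finType) (V : zmodType) (A : {set I}) (B : {set J})
    (F : I -> V) (G : J -> V) :
    #|A| = #|B| -> (forall i j, i \in A -> j \in B -> F i = G j) ->
  \sum_(i in A) F i = \sum_(j in B) G j.
Proof.
move=> cAB FG; have [A0|[i iA]] := set_0Vmem A.
  move: cAB; rewrite A0 cards0 => /esym/eqP; rewrite cards_eq0 => /eqP ->.
  by rewrite !big_set0.
have /set0Pn[j jB] : B != set0.
  by rewrite -card_gt0 -cAB card_gt0; apply/set0Pn; exists i.
rewrite (eq_bigr (fun=> G j)) => [|k kA]; last exact: FG.
rewrite [RHS](eq_bigr (fun=> G j)) => [|k kB]; last by rewrite -(FG i k) // (FG i j).
by rewrite !sumr_const cAB.
Qed.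

Lemma beta_block B : B \in P -> beta B \in P'.
Proof. by move=> hB; rewrite -beta_im imset_f. Qed.

(** The ground sets have the same size, as the largest flats of the two
    configurations have, and therefore belong to corresponding blocks. *)
Lemma ground_block : [/\ #|E| = #|E'|, rk M setT = rk M' setT
  & exists2 C, C \in P & setT \in C /\ setT \in beta C].
Proof.
have [C hC TC] := cyclic_flat_block hP (setT_cyclic_flat nlc).
have [C' hC' TC'] := cyclic_flat_block hP' (setT_cyclic_flat nlc').
have hbC := beta_block hC.
have eE : block_size C = #|E| by rewrite (block_sizeE hP hC TC) cardsT.
have eE' : block_size C' = #|E'| by rewrite (block_sizeE hP' hC' TC') cardsT.
have bC := mem_block_flat hP' hbC.
have le1 : (#|E| <= #|E'|)%N by rewrite -eE -beta_size // max_card.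
have le2 : (#|E'| <= #|E|)%N.
  by rewrite -eE'; move: hC'; rewrite -beta_im => /imsetP[B hB ->];
    rewrite beta_size // max_card.
have cE : #|E| = #|E'| by apply/eqP; rewrite eqn_leq le1.
have TbC : setT \in beta C.
  suff <- : block_flat (beta C) = setT by [].
  by apply/eqP; rewrite eqEcard subsetT cardsT -cE -eE -beta_size // leqnn.
split=> //; last by exists C.
by rewrite -(block_rankE hP hC TC) -beta_rank // (block_rankE hP' hbC TbC).
Qed.

(** The flats of a block below a given flat are counted by the configuration and
    contribute equally, by induction on the depth of the recursion. *)
Lemma flag_sum_condensed (V : zmodType) (w : seq {set E} -> V) (w' : seq {set E'} -> V) :
    (forall c c', flag M set0 c -> flag M' set0 c' -> profile M c = profile M' c' ->
       w c = w' c') ->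
  forall n C Y Y' c c', C \in P -> Y \in C -> Y' \in beta C ->
    flag M Y c -> flag M' Y' c' -> profile M c = profile M' c' ->
  flag_sum M w n Y c = flag_sum M' w' n Y' c'.
Proof.
move=> ww; elim=> [|n IH] C Y Y' c c' hC hY hY' fc fc' pc.
  by rewrite !flag_sum0; apply: ww => //; [apply: flag0 fc | apply: flag0 fc'].
rewrite !flag_sumS (ww c c' (flag0 fc) (flag0 fc') pc).
congr (_ + _); rewrite (sum_below hP) (sum_below hP') -beta_im big_imset //=.
apply: eq_bigr => B hB; have hbB := beta_block hB; have hbC := beta_block hC.
apply: sum_const_eq.
  rewrite (block_below hP hB hC hY) (block_below hP' hbB hbC hY').
  by rewrite !beta_size // beta_count.
move=> X X' /setIP[hX XY] /setIP[hX' XY'].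
congr (_ - _); apply: (IH B) => //.
- exact: flag_cons XY fc.
- exact: flag_cons XY' fc'.
- rewrite /profile /= -/(profile M c) -/(profile M' c') pc.
  rewrite -(block_sizeE hP hB hX) -(block_rankE hP hB hX).
  by rewrite -(block_sizeE hP' hbB hX') -(block_rankE hP' hbB hX') beta_size // beta_rank.
- exact: flag_below XY fc.
- exact: flag_below XY' fc'.
Qed.

Lemma flag_sum_ground (V : zmodType) (w : seq {set E} -> V) (w' : seq {set E'} -> V) :
    (forall c c', flag M set0 c -> flag M' set0 c' -> profile M c = profile M' c' ->
       w c = w' c') ->
  flag_sum M w #|E| setT [::] = flag_sum M' w' #|E'| setT [::].
Proof.
move=> ww; have [<- _ [C hC [TC TC']]] := ground_block.
exact: (flag_sum_condensed ww _ hC TC TC').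
Qed.

End CondensedConfiguration.

(** * Valuative and covaluative invariants *)

Section NestedPolytopes.
Variables (R : realType) (E : finType) (M : matroid E).
Implicit Types (c : seq {set E}) (x : E -> R^o) (Z : {set E}).

Definition in_box x := [forall i, 0 <= x i <= 1] && (mass x setT == (rk M setT)%:R).

Definition in_open_box x := [forall i, 0 < x i < 1] && (mass x setT == (rk M setT)%:R).

Lemma in_boxP x : reflect
  ((forall i, 0 <= x i <= 1) /\ mass x setT = (rk M setT)%:R) (in_box x).
Proof. by apply: (iffP andP) => -[/forallP ? /eqP ?]. Qed.

Lemma in_open_boxP x : reflect
  ((forall i, 0 < x i < 1) /\ mass x setT = (rk M setT)%:R) (in_open_box x).
Proof. by apply: (iffP andP) => -[/forallP ? /eqP ?]. Qed.

Lemma matroid_polytopeP x : base_polytope M x <->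
  in_box x && [forall Z, cyclic_flat M Z ==> satisfied M x Z].
Proof.
rewrite (base_polytopeP (F := cyclic_flat M) (rho := rk M)); last 2 first.
- by move=> B Z hB _; apply: basis_rk.
- exact: rk_cyclic_flat.
split=> [[x01 xT h]|/andP[/in_boxP[x01 xT] /forallP h]].
  apply/andP; split; first exact/in_boxP.
  by apply/forallP => Z; apply/implyP => /h.
by split=> // Z; apply/implyP/h.
Qed.

Lemma matroid_relintP x : no_loops_coloops M ->
  relint (base_polytope M) x <-> in_open_box x && interior M x.
Proof.
move=> nlc; rewrite (relint_base_polytopeP (F := cyclic_flat M) (rho := rk M)) //;
  last 2 first.
- by move=> B Z hB _; apply: basis_rk.
- exact: rk_cyclic_flat.
split=> [[x01 xT h]|/andP[/in_open_boxP[x01 xT] /forallP h]].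
  apply/andP; split; first exact/in_open_boxP.
  apply/forallP => Z; apply/implyP => /h[le hr]; rewrite /satisfied le /=.
  by apply/implyP => /eqP/hr r; apply/rigidP.
split=> // Z cZ; have := h Z; rewrite cZ /= => /andP[le hr]; split=> // e B.
by apply/rigidP; apply: (implyP hr); apply/eqP.
Qed.

Section Chain.
Variable c : seq {set E}.
Hypothesis fc : flag M set0 c.
Let hc : chain_above set0 c := proj1 (andP fc).
Let N := nested_matroid M c.

Lemma nested_rank_ub B Z : B \in bases N -> Z \in [:: set0, setT & c] -> (#|B :&: Z| <= rk M Z)%N.
Proof.
move=> hB; have cB := card_basis hB; move: hB cB.
rewrite (bases_nested_matroid M hc) (rkT_nested M hc) => /nested_basesP[_ h] cB.
by rewrite !inE => /or3P[/eqP->|/eqP->|/h//]; rewrite ?setI0 ?cards0 // setIT cB.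
Qed.

Lemma nested_polytopeP x : base_polytope N x <-> in_box x && all (satisfied M x) c.
Proof.
rewrite (base_polytopeP (F := mem [:: set0, setT & c]) (rho := rk M)); last 2 first.
- exact: nested_rank_ub.
- exact: rk_nested hc.
rewrite (rkT_nested M hc).
split=> [[x01 xT h]|/andP[/in_boxP[x01 xT] /allP h]].
  apply/andP; split; first exact/in_boxP.
  by apply/allP => Z cZ; apply: h; rewrite /= !inE cZ !orbT.
split=> // Z; rewrite /= !inE => /or3P[/eqP->|/eqP->|/h//].
  by rewrite mass0.
by rewrite xT.
Qed.

Lemma nested_relintP x : no_loops_coloops M ->
  relint (base_polytope N) x <-> in_open_box x && all (strict M x) c.
Proof.
move=> nlc;
  rewrite (relint_base_polytopeP (F := mem [:: set0, setT & c]) (rho := rk M));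
  last 3 first.
- exact: nested_rank_ub.
- exact: rk_nested hc.
- exact: nested_no_loops_coloops hc nlc.
rewrite (rkT_nested M hc).
split=> [[x01 xT h]|/andP[/in_open_boxP[x01 xT] /allP h]].
  apply/andP; split; first exact/in_open_boxP.
  apply/allP => Z cZ; have [] := h Z; first by rewrite /= !inE cZ !orbT.
  rewrite /strict lt_neqAle => -> r; rewrite andbT; apply/negP => /eqP /r rZ.
  have /allP/(_ Z cZ)/and3P[_ Z0 ZT] := proj2 (andP fc).
  have [B /rZ ->] := nested_not_rigid hc nlc cZ Z0 ZT.
  by rewrite ltnn.
split=> // Z; rewrite /= !inE => /or3P[/eqP->|/eqP->|/h lt].
- by rewrite mass0 rk0; split=> // _ B _; rewrite setI0 cards0.
- by rewrite xT; split=> // _ B /card_basis; rewrite (rkT_nested M hc) setIT.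
- by split; [apply: ltW | move=> e; move: lt; rewrite /strict e ltxx].
Qed.

End Chain.

Lemma indic_bool (A : (E -> R^o) -> Prop) x (b : bool) :
  (A x <-> b) -> \1_A%classic x = b%:R :> int.
Proof.
move=> h; rewrite indicE; congr (_%:R); congr nat_of_bool.
by apply/idP/idP => [|/h]; rewrite in_setE // => /h.
Qed.

Lemma flag_sum_mull (k : int) (w : seq {set E} -> int) n Y c :
  flag_sum M (fun c' => k * w c') n Y c = k * flag_sum M w n Y c.
Proof. by rewrite /flag_sum mulr_sumr; apply: eq_bigr => p _; rewrite mulrzAr. Qed.

(** Outside the box both sides vanish.  In the box, the indicator function of a
    nested polytope is the product of the indicators of the inequalities of its
    chain. *)
Lemma polytope_flag_sum x :
  flag_sum M (fun c => \1_(base_polytope (nested_matroid M c)) x : int) #|E| setT [::] =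
  1 * \1_(base_polytope M) x.
Proof.
rewrite mul1r (eq_flag_sum (w' := fun c => (in_box x)%:R * all_good (satisfied M x) c)) //.
  rewrite flag_sum_mull (indic_bool (matroid_polytopeP x)) -mulnb natrM.
  have [/in_boxP[x01 xT]|_] := boolP (in_box x); last by rewrite !mul0r.
  by rewrite flag_sum_closed.
move=> c fc; rewrite (indic_bool (nested_polytopeP fc x)).
by rewrite /all_good -natrM mulnb.
Qed.

Lemma relint_flag_sum x : no_loops_coloops M ->
  flag_sum M (fun c =>
    \1_(relint (base_polytope (nested_matroid M c))) x : int) #|E| setT [::] =
  interior_sign M * \1_(relint (base_polytope M)) x.
Proof.
move=> nlc; rewrite (eq_flag_sum (w' := fun c =>
  (in_open_box x)%:R * all_good (strict M x) c)) //.
  rewrite flag_sum_mull (indic_bool (matroid_relintP x nlc)) -mulnb natrM.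
  have [/in_open_boxP[x01 xT]|_] := boolP (in_open_box x); last by rewrite !mul0r mulr0.
  by rewrite flag_sum_open // !mul1r.
move=> c fc; rewrite (indic_bool (nested_relintP fc x nlc)).
by rewrite /all_good -natrM mulnb.
Qed.

(** A flag sum, completed by [M] with the coefficient [- s], is one of the finite
    combinations of matroids that occur in the definitions of valuations and
    covaluations. *)
Lemma flag_sum_relation (G : zmodType) (Phi : matroid E -> G)
    (region : matroid E -> (E -> R^o) -> Prop) (s : int) n :
    (forall k (a : 'I_k -> int) (N : 'I_k -> matroid E),
       (forall x, \sum_(i < k) a i * \1_(region (N i))%classic x = 0) ->
       \sum_(i < k) Phi (N i) *~ a i = 0) ->
    (forall x, flag_sum M (fun c =>
      \1_(region (nested_matroid M c))%classic x : int) n setT [::]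
               = s * \1_(region M)%classic x) ->
  flag_sum M (fun c => Phi (nested_matroid M c)) n setT [::] = Phi M *~ s.
Proof.
move=> hPhi hx; set ms := marked_flags M n setT [::].
pose L := (- s, M) :: [seq (p.1, nested_matroid M p.2) | p <- ms].
have := hPhi (size L) (fun i => (tnth (in_tuple L) i).1) (fun i => (tnth (in_tuple L) i).2).
rewrite -(big_tnth _ _ L xpredT (fun p => Phi p.2 *~ p.1)) /L big_cons big_map /=.
move=> rel; apply/eqP; rewrite -subr_eq0 -mulrNz addrC; apply/eqP; apply: rel => x.
rewrite -(big_tnth _ _ L xpredT (fun p =>
  p.1 * \1_(region p.2)%classic x)) /L big_cons big_map /=.
rewrite mulNr -hx /flag_sum addrC; apply/eqP; rewrite subr_eq0; apply/eqP.
by apply: eq_bigr => p _; rewrite -mulrzr intz mulrC.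
Qed.

End NestedPolytopes.

(** A point of the space of one ground set has no counterpart in the other.
    Summing over all placements of its coordinates gives a quantity that depends on
    a flag only through its profile, hence can be compared between two matroids. *)
Section Placements.
Variables (R : realType) (E : finType) (x : E -> R).

Definition placements (F : finType) (N : matroid F) (c : seq {set F}) : int :=
  \sum_(g : {ffun F -> E} | injectiveb g) all_good (strict N (x \o g)) c.

Lemma placements_profile (F F' : finType) (N : matroid F) (N' : matroid F')
    (c : seq {set F}) (c' : seq {set F'}) :
    #|F| = #|F'| -> chain_above set0 c -> chain_above set0 c' ->
    profile N c = profile N' c' ->
  placements N c = placements N' c'.
Proof.
move=> FF' hc hc' pc; have [f [f' ff' f'f] hf] := profile_bijection FF' hc hc' pc.
have bf : bijective f by exists f'.
pose h (g : {ffun F' -> E}) := [ffun e => g (f e)].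
pose h' (g : {ffun F -> E}) := [ffun e => g (f' e)].
rewrite /placements (reindex h) /=; last first.
  by exists h' => g _; apply/ffunP => e; rewrite !ffunE ?ff' ?f'f.
apply: eq_big => g.
  apply/injectiveP/injectiveP => gi a b; last first.
    by rewrite !ffunE => /gi /(bij_inj bf).
  by move=> e; rewrite -(f'f a) -(f'f b); congr f; apply: gi; rewrite !ffunE !f'f.
move=> _; rewrite /all_good; congr (_%:R); congr nat_of_bool.
have sc := profile_size pc.
have E1 k : strict N (x \o h g) (nth set0 c k) = strict N' (x \o g) (nth set0 c' k).
  rewrite /strict (profile_rk pc); congr (_ < _).
  rewrite /mass [RHS](reindex f) /=; last exact: onW_bij.
  by apply: eq_big => e; rewrite ?hf // ffunE.
apply/(all_nthP set0)/(all_nthP set0) => hk k kc.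
  by rewrite -E1 hk // sc.
by rewrite E1 hk // -sc.
Qed.

Lemma placements_flag_sum (F : finType) (N : matroid F) :
    #|F| = #|E| -> (forall i, 0 < x i < 1) -> mass x setT = (rk N setT)%:R ->
  flag_sum N (placements N) #|F| setT [::] =
  interior_sign N * \sum_(g : {ffun F -> E} | injectiveb g) (interior N (x \o g))%:R.
Proof.
move=> FE x01 xT; rewrite flag_sum_sum mulr_sumr; apply: eq_bigr => g /injectiveP gi.
rewrite flag_sum_open // => [i|]; first exact: x01.
have bg : bijective g by apply: inj_card_bij; rewrite ?FE.
rewrite -xT /mass [RHS](reindex g) /=; last exact: onW_bij.
by apply: eq_bigl => i; rewrite !inE.
Qed.

End Placements.

Theorem mainTheorem1 (R : realType) (E E' : finType)
  (M : matroid E) (M' : matroid E')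
  (P : {set {set {set E}}}) (P' : {set {set {set E'}}})
  (beta : {set {set E}} -> {set {set E'}})
  (M_nlc : no_loops_coloops M) (M'_nlc : no_loops_coloops M')
  (P_cond : condensation M P) (P'_cond : condensation M' P')
  (beta_inj : {in P &, injective beta}) (beta_im : beta @: P = P')
  (beta_size : forall B, B \in P -> block_size (beta B) = block_size B)
  (beta_rank : forall B, B \in P -> block_rank M' (beta B) = block_rank M B)
  (beta_count : forall B C, B \in P -> C \in P ->
     block_count (beta B) (beta C) = block_count B C)
  (G : zmodType) (Phi : forall F : finType, matroid F -> G) :
  (valuative_invariant R Phi -> Phi E M = Phi E' M') /\
  (covaluative_invariant R Phi -> Phi E M = Phi E' M').
Proof.
have [EE' rT _] := ground_block M_nlc M'_nlc P_cond P'_cond beta_im beta_size beta_rank.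
have compare (V : zmodType) := flag_sum_ground M_nlc M'_nlc P_cond P'_cond beta_inj beta_im
  beta_size beta_rank beta_count (V := V).
have nested_eq : matroid_invariant Phi ->
    flag_sum M (fun c => Phi E (nested_matroid M c)) #|E| setT [::] =
    flag_sum M' (fun c => Phi E' (nested_matroid M' c)) #|E'| setT [::].
  move=> inv; apply: compare => c c' /andP[hc _] /andP[hc' _] pc.
  by apply: inv; apply: profile_iso.
(* Both sides of [e] below are the same sum over placements of an interior point
   [x] of [M]; the identity placement makes the factor [a] nonzero. *)
have sign_eq : interior_sign M = interior_sign M'.
  have [x [x01 xT hx]] := exists_interior R M_nlc.
  have xT' : mass x setT = (rk M' setT)%:R by rewrite xT rT.
  have := placements_flag_sum (erefl _) x01 xT.
  rewrite (compare _ _ (placements x M')) => [|c c' /andP[hc _] /andP[hc' _] pc];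
    last first.
    exact: placements_profile.
  rewrite (placements_flag_sum (esym EE') x01 xT').
  set a' := \sum_(_ | _) _; set a := \sum_(_ | _) _ => e.
  have a'0 : 0 <= a' by apply: sumr_ge0.
  have a0 : 0 < a.
    have inj1 : injectiveb [ffun i : E => i] by apply/injectiveP => i j; rewrite !ffunE.
    rewrite /a (bigD1 [ffun i : E => i]) //= ltr_pwDl ?sumr_ge0 //.
    have -> : x \o [ffun i : E => i] = x by apply: funext => i /=; rewrite ffunE.
    by rewrite hx.
  move: e; have [->|->] := interior_sign_pm1 R M_nlc;
    have [->|->] := interior_sign_pm1 R M'_nlc => //;
    by rewrite !mul1r !mulN1r; lia.
split=> -[inv val].
- have := flag_sum_relation (val E) (@polytope_flag_sum R E M).
  rewrite nested_eq // (flag_sum_relation (val E') (@polytope_flag_sum R E' M')).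
  by rewrite !mulr1z.
- have := flag_sum_relation (region := fun N =>
  relint (base_polytope N)) (val E) (fun x => @relint_flag_sum R E M x M_nlc).
  rewrite nested_eq // (flag_sum_relation (region := fun N =>
    relint (base_polytope N)) (val E') (fun x => @relint_flag_sum R E' M' x M'_nlc)).
  rewrite sign_eq; have [->|->] := interior_sign_pm1 R M'_nlc; first by rewrite !mulr1z.
  by rewrite !mulrN1z => /oppr_inj.
Qed.
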